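(* Let $\phi:\mathbb{R}^n\to\mathbb{R}\cup\{\infty\}$ be proper, closed and $\lambda$-strongly convex with $\lambda\ge0$, and assume that there is an open, convex set $U$ containing $\mathrm{dom}\,\phi$. Let $f(\cdot;s)$ be $\rho_s$-weakly convex with $\rho_s>0$ for all $s\in\mathcal{S}$ and let $\rho=\mathbb{E}[\rho_S]<\infty$. Assume that for all $s\in\mathcal{S}$ there exists $G_s\in\mathbb{R}_+$ such that $\mathsf{G}:=\sqrt{\mathbb{E}[G_S^2]}<\infty$ and $\|g\|\le G_s$ for all $x\in U$ and all $g\in\partial f(x;s)$. Let $\Delta>0$ satisfy $\Delta\ge\mathrm{env}^{1/(2\rho)}_\psi(x^0)-\min\psi$. Let $\{x^k\}_{k=0,\dots,K}$ be generated by the algorithm ProxSPS with constant step sizes $\alpha_k=\Big(2\rho+\sqrt{\frac{4\rho\mathsf{G}^2K}{\Delta}}\Big)^{-1}$. Then $$\mathbb{E}\|\nabla\mathrm{env}^{1/(2\rho)}_\psi(x^K_\sim)\|^2\le\frac{8\rho\Delta}{K}+16\,\mathsf{G}\sqrt{\frac{\rho\Delta}{K}},$$ where $x^K_\sim$ is drawn uniformly from $\{x^0,\dots,x^{K-1}\}$.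
   Context: Setting. $S$ is a random variable with values in a sample space $\mathcal{S}$ and distribution $P$; $\mathbb{E}$ denotes expectation, $\mathbb{E}[X(S)]=\int_{\mathcal{S}}X(s)\,dP(s)$. For each $s\in\mathcal{S}$, $f(\cdot;s):\mathbb{R}^n\to\mathbb{R}$ is locally Lipschitz with Clarke subdifferential $\partial f(\cdot;s)$ (for weakly convex functions this coincides with the regular subdifferential), and $f(x):=\mathbb{E}[f(x;S)]$ is real-valued on $\mathbb{R}^n$. For $\phi:\mathbb{R}^n\to\mathbb{R}\cup\{\infty\}$ put $\psi:=f+\phi$ (whose minimum $\min\psi$ is assumed to exist). For every $s$, $\inf_xf(x;s)$ is finite and a number $C(s)\le\inf_xf(x;s)$ is given. Infinitely many i.i.d. realizations $S_0,S_1,\dots$ distributed as $S$ can be drawn. ''$\lambda$-strongly convex'' with $\lambda=0$ means convex. A function $h$ is $\rho$-weakly convex ($\rho\ge0$) if $h+\frac{\rho}{2}\|\cdot\|^2$ is convex. Moreau envelope: $\mathrm{env}^\eta_\psi(x):=\min_y\psi(y)+\frac{1}{2\eta}\|y-x\|^2$, with gradient $\nabla\mathrm{env}^\eta_\psi(x)=\eta^{-1}(x-\mathrm{prox}_{\eta\psi}(x))$, where $\mathrm{prox}_{\eta\psi}(x):=\arg\min_y\psi(y)+\frac{1}{2\eta}\|y-x\|^2$. Algorithm ProxSPS. Given $x^0\in\mathbb{R}^n$ and step sizes $\alpha_k>0$, for $k=0,1,\dots,K-1$ (with $K\ge1$): sample $S_k\sim P$ independently of the past, choose $g_k\in\partial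 f(x^k;S_k)$, and set $$x^{k+1}=\arg\min_{y\in\mathbb{R}^n}\ \max\{f(x^k;S_k)+\langle g_k,y-x^k\rangle,\,C(S_k)\}+\phi(y)+\frac{1}{2\alpha_k}\|y-x^k\|^2 .$$
   Formalization: The formal theorem additionally assumes that the starting point x^0 lies in U; for x^0 outside U the subgradient bound is unavailable at x^0 and the stated inequality can fail (already for n=1, K=2). *)

(* Defs.v *)
From HB Require Import structures.
From mathcomp Require Import all_boot all_order all_algebra.
From mathcomp Require Import all_classical all_reals all_analysis.
Set Implicit Arguments.
Unset Strict Implicit.
Unset Printing Implicit Defensive.
Import Order.TTheory GRing.Theory Num.Theory.
Import numFieldNormedType.Exports.
Local Open Scope classical_set_scope.
Local Open Scope ring_scope.

(* R^n is 'rV[R]_n. The norm `|x| provided by the library on 'rV[R]_n is the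
   max-norm; it induces the usual topology, but all metric quantities below
   use the Euclidean norm enorm. *)

Definition dot (R : realType) (n : nat) (x y : 'rV[R]_n) : R :=
  \sum_j x 0 j * y 0 j.

Definition enorm (R : realType) (n : nat) (x : 'rV[R]_n) : R :=
  Num.sqrt (dot x x).

Definition locally_lipschitz (R : realType) (n : nat) (h : 'rV[R]_n -> R) :=
  forall x : 'rV[R]_n, lipschitz_on (h : 'rV[R]_n -> R^o) (nbhs (x, x)).

(* Clarke's generalized directional derivative:
   limsup of (h (y + t v) - h y) / t as y --> x and t decreases to 0. *)
Definition clarke_dd (R : realType) (n : nat) (h : 'rV[R]_n -> R)
    (x v : 'rV[R]_n) : \bar R :=
  limf_esup (fun p : 'rV[R]_n * R => ((h (p.1 + p.2 *: v) - h p.1) / p.2)%:E)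
    (filter_prod (nbhs x) ((0 : R)^'+)).

Definition clarke_subdiff (R : realType) (n : nat) (h : 'rV[R]_n -> R)
    (x : 'rV[R]_n) : set 'rV[R]_n :=
  [set g | forall v, ((dot g v)%:E <= clarke_dd h x v)%E].

Definition weakly_convex (R : realType) (n : nat) (rho : R)
    (h : 'rV[R]_n -> R) :=
  convex_function setT (fun x : 'rV[R]_n => h x + rho / 2 * enorm x ^+ 2).

(* Only meant for functions that do not take the value -oo. *)
Definition econvex (R : realType) (n : nat) (h : 'rV[R]_n -> \bar R) :=
  forall (x y : 'rV[R]_n) (t : R), 0 <= t -> t <= 1 ->
    (h (t *: x + (1 - t) *: y)%R <= t%:E * h x + (1 - t)%:E * h y)%E.

Definition strongly_convex (R : realType) (n : nat) (lambda : R)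
    (h : 'rV[R]_n -> \bar R) :=
  econvex (fun x => h x - (lambda / 2 * enorm x ^+ 2)%:E)%E.

Definition edom (R : realType) (n : nat) (h : 'rV[R]_n -> \bar R) :
  set 'rV[R]_n := [set x | (h x < +oo)%E].

Definition eproper (R : realType) (n : nat) (h : 'rV[R]_n -> \bar R) :=
  (forall x, h x != -oo%E) /\ edom h !=set0.

Definition closed_fun (R : realType) (n : nat) (h : 'rV[R]_n -> \bar R) :=
  closed [set p : 'rV[R]_n * R | (h p.1 <= p.2%:E)%E].

Definition argmin (R : realType) (n : nat) (h : 'rV[R]_n -> \bar R) :
  set 'rV[R]_n := [set x | forall y, (h x <= h y)%E].

Definition emin (R : realType) (n : nat) (h : 'rV[R]_n -> \bar R) : \bar R :=
  ereal_inf (range h).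

Definition env (R : realType) (n : nat) (eta : R) (psi : 'rV[R]_n -> \bar R)
    (x : 'rV[R]_n) : \bar R :=
  emin (fun y => psi y + (1 / (2 * eta) * enorm (y - x) ^+ 2)%:E)%E.

(* The vector representing the Frechet differential 'd h x. *)
Definition gradient (R : realType) (n : nat) (h : 'rV[R]_n -> R)
    (x : 'rV[R]_n) : 'rV[R]_n :=
  \row_j ('d (h : 'rV[R]_n -> R^o) x (delta_mx 0 j)).

(* The expected objective x |-> E[f(x; S)], S distributed as P, where f s x
   stands for f(x; s). *)
Definition mean_fun (d : measure_display) (T : measurableType d)
    (R : realType) (P : probability T R) (n : nat) (f : T -> 'rV[R]_n -> R)
    (x : 'rV[R]_n) : R :=
  fine ('E_P[fun s => f s x])%E.

Definition measurable_rV (d : measure_display) (Omega : measurableType d)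
    (R : realType) (n : nat) (X : Omega -> 'rV[R]_n) :=
  forall j, measurable_fun setT (fun w => X w 0 j).

Definition rV_events (d : measure_display) (Omega : measurableType d)
    (R : realType) (n : nat) (X : Omega -> 'rV[R]_n) : set (set Omega) :=
  \bigcup_(j in [set: 'I_n])
    preimage_set_system setT (fun w => X w 0 j) measurable.

Definition indep_systems (d : measure_display) (Omega : measurableType d)
    (R : realType) (Pr : probability Omega R) (F G : set (set Omega)) :=
  forall A B, F A -> G B -> Pr (A `&` B) = (Pr A * Pr B)%E.

(* The sigma-algebra known before the k-th sample is drawn, generated by
   x^0, ..., x^k, S_0, ..., S_{k-1} and g_0, ..., g_{k-1}. *)
Definition past (dO dS : measure_display) (Omega : measurableType dO)
    (T : measurableType dS) (R : realType) (n : nat)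
    (S : nat -> Omega -> T) (g x : nat -> Omega -> 'rV[R]_n) (k : nat) :
    set (set Omega) :=
  <<s (\bigcup_(i in `I_k.+1) rV_events (x i)) `|`
      (\bigcup_(i in `I_k) (preimage_set_system setT (S i) measurable `|`
                            rV_events (g i))) >>.

Definition prox_sps_model (R : realType) (n : nat) (fs : 'rV[R]_n -> R)
    (phi : 'rV[R]_n -> \bar R) (c alpha : R) (xk gk y : 'rV[R]_n) : \bar R :=
  ((Num.max (fs xk + dot gk (y - xk)) c)%:E + phi y
   + (1 / (2 * alpha) * enorm (y - xk) ^+ 2)%:E)%E.

(* K iterations of ProxSPS from x0 with step sizes alpha. The choice of g_k in
   the subdifferential may depend on the past and on extra randomness. *)
Record prox_sps (dO dS : measure_display) (Omega : measurableType dO)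
    (T : measurableType dS) (R : realType) (Pr : probability Omega R)
    (P : probability T R) (n : nat) (f : T -> 'rV[R]_n -> R)
    (phi : 'rV[R]_n -> \bar R) (C : T -> R) (x0 : 'rV[R]_n)
    (alpha : nat -> R) (K : nat) (S : nat -> Omega -> T)
    (g x : nat -> Omega -> 'rV[R]_n) : Prop := ProxSPS {
  sps_S_meas : forall k, (k < K)%N -> measurable_fun setT (S k) ;
  sps_g_meas : forall k, (k < K)%N -> measurable_rV (g k) ;
  sps_x_meas : forall k, (k <= K)%N -> measurable_rV (x k) ;
  sps_law : forall k, (k < K)%N ->
    forall A, measurable A -> Pr (S k @^-1` A) = P A ;
  sps_indep : forall k, (k < K)%N ->
    indep_systems Pr (preimage_set_system setT (S k) measurable)
      (past S g x k) ;
  sps_init : forall w, x 0%N w = x0 ;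
  sps_g : forall k, (k < K)%N -> forall w,
    clarke_subdiff (f (S k w)) (x k w) (g k w) ;
  sps_step : forall k, (k < K)%N -> forall w,
    argmin (prox_sps_model (f (S k w)) phi (C (S k w)) (alpha k)
              (x k w) (g k w)) (x k.+1 w)
}.

(* J is a uniformly distributed index, independent of x^0, ..., x^{K-1};
   x^K_~ is then w |-> x (J w) w. *)
Record uniform_index (d : measure_display) (Omega : measurableType d)
    (R : realType) (Pr : probability Omega R) (n K : nat)
    (x : nat -> Omega -> 'rV[R]_n) (J : Omega -> 'I_K) : Prop := UniformIndex {
  uidx_meas : forall j, measurable (J @^-1` [set j]) ;
  uidx_law : forall j, Pr (J @^-1` [set j]) = (K%:R^-1)%:E ;
  uidx_indep : indep_systems Pr (preimage_set_system setT J setT)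
    <<s \bigcup_(k in `I_K) rV_events (x k) >>
}.

(* Main.v *)
Require Import Defs.
From HB Require Import structures.
From mathcomp Require Import all_boot all_order all_algebra.
From mathcomp Require Import all_classical all_reals all_analysis.
From mathcomp Require Import measurable_realfun.
From mathcomp Require Import ring lra.
Set Implicit Arguments.
Unset Strict Implicit.
Unset Printing Implicit Defensive.
Import Order.TTheory GRing.Theory Num.Theory.
Import numFieldNormedType.Exports.
Local Open Scope classical_set_scope.
Local Open Scope ring_scope.

(** The proof follows the value of the Moreau envelope along the iterates. Let
    [xh] be the proximal point of the current point [x], that is, the minimiser
    of [psi + rho |. - x|^2], whose optimal value [menv x] is the envelope. Since
    [psi] is [rho]-weakly convex, this problem is strongly convex, and
    [gradient_menv] shows that the gradient of the envelope at [x] is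
    [2 rho (x - xh)]. It therefore suffices to bound the expectation of
    [|x - xh|^2] along the run.

    Three inequalities are combined at each step (lemma [step_decrease]).
    First, the next point [xp] minimises a strongly convex model, hence satisfies
    a three-point inequality, which is used at [xh] ([model_step]); the model
    exceeds the sample function by at most [rhos / 2 * |. - x|^2], because a
    Clarke subgradient of a weakly convex function is a subgradient up to that
    quadratic term ([clarke_subgradient]), and the truncation level [C] is below
    the sample function anyway. Second, the objective at [xp] is compared with its value at
    [xh] through the quadratic growth of the proximal problem ([menv_growth]).
    Third, the expected objective [F] is Lipschitz on [U]
    ([objective_lipschitz]), so it may be evaluated at [x] instead of [xp]. What
    remains is an error of the form [(Gs + L) t - r / 2 * t^2], with
    [t = |xp - x|], and the difference between the sample-dependent quantity
    [sample_term] and its mean over the sample.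

    That difference has expectation zero: the sample is independent of the past,
    so the current point can be frozen when integrating over the sample
    ([mean_freeze], a form of Fubini's theorem). Taking expectations gives
    [expected_decrease], where the envelope decreases on average by a multiple of
    [|x - xh|^2] up to an error of order [G^2]. The sum over the iterations
    telescopes; [mean_uniform_index] turns it into the expectation at the random
    index, and the choice of the step size balances the two errors
    ([rate_bound]).

    The bound on Clarke subgradients yields the Lipschitz constant
    ([clarke_lipschitz]) through proximal points of the sample function: they lie
    close to any given point, and an explicit Clarke subgradient exists at them
    ([prox_clarke]). *)

(** * Euclidean geometry *)

Section Euclid.
Variables (R : realType) (n : nat).
Implicit Types (x y z : 'rV[R]_n) (t c : R).

Lemma dotC x y : dot x y = dot y x.
Proof. by apply: eq_bigr => j _; rewrite mulrC. Qed.

Lemma dotDl x y z : dot (x + y) z = dot x z + dot y z.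
Proof. by rewrite -big_split; apply: eq_bigr => j _ /=; rewrite mxE mulrDl. Qed.

Lemma dotDr x y z : dot z (x + y) = dot z x + dot z y.
Proof. by rewrite !(dotC z) dotDl. Qed.

Lemma dotZl t x y : dot (t *: x) y = t * dot x y.
Proof. by rewrite mulr_sumr; apply: eq_bigr => j _ /=; rewrite mxE mulrA. Qed.

Lemma dotZr t x y : dot x (t *: y) = t * dot x y.
Proof. by rewrite dotC dotZl dotC. Qed.

Lemma dotNl x y : dot (- x) y = - dot x y.
Proof. by rewrite -scaleN1r dotZl mulN1r. Qed.

Lemma dotNr x y : dot x (- y) = - dot x y.
Proof. by rewrite dotC dotNl dotC. Qed.

Definition dotE := (dotDl, dotDr, dotNl, dotNr, dotZl, dotZr).

Lemma dot_ge0 x : 0 <= dot x x.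
Proof. by apply: sumr_ge0 => j _; rewrite -expr2 sqr_ge0. Qed.

Lemma enorm_ge0 x : 0 <= enorm x.
Proof. exact: sqrtr_ge0. Qed.

Lemma enorm_sqr x : enorm x ^+ 2 = dot x x.
Proof. by rewrite sqr_sqrtr// dot_ge0. Qed.

Lemma enormN x : enorm (- x) = enorm x.
Proof. by rewrite /enorm !dotE opprK. Qed.

Lemma enormC x y : enorm (x - y) = enorm (y - x).
Proof. by rewrite -enormN opprB. Qed.

Lemma enormZ t x : enorm (t *: x) = `|t| * enorm x.
Proof. by rewrite /enorm !dotE mulrA -expr2 sqrtrM ?sqr_ge0// sqrtr_sqr. Qed.

Lemma enorm0 : enorm (0 : 'rV[R]_n) = 0.
Proof. by rewrite -(scale0r 0) enormZ normr0 mul0r. Qed.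

Lemma enorm_eq0_coord x j : enorm x = 0 -> x 0 j = 0.
Proof.
move=> x0; have /eqP := enorm_sqr x; rewrite x0 expr0n/= eq_sym psumr_eq0.
  by move/allP => /(_ j (mem_index_enum _)); rewrite mulf_eq0 orbb => /eqP.
by move=> i _; rewrite -expr2 sqr_ge0.
Qed.

(** If [x] and [y] have norms [a], [b], the polynomial inequality
    [0 <= |b x - a y|^2] reads [2 a b (a b - <x, y>) >= 0]. *)
Lemma dot_le_enorm x y : dot x y <= enorm x * enorm y.
Proof.
have [x0|x0] := eqVneq (enorm x) 0.
  by rewrite x0 mul0r /dot big1// => j _; rewrite enorm_eq0_coord// mul0r.
have [y0|y0] := eqVneq (enorm y) 0.
  by rewrite y0 mulr0 /dot big1// => j _; rewrite [y 0 j]enorm_eq0_coord// mulr0.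
have xp : 0 < enorm x by rewrite lt_neqAle eq_sym x0 enorm_ge0.
have yp : 0 < enorm y by rewrite lt_neqAle eq_sym y0 enorm_ge0.
have := dot_ge0 (enorm y *: x - enorm x *: y).
rewrite !dotE (dotC y x) -!enorm_sqr => H.
rewrite -(ler_pM2l (mulr_gt0 xp yp)); lra.
Qed.

Lemma normr_dot x y : `|dot x y| <= enorm x * enorm y.
Proof.
rewrite ler_norml dot_le_enorm andbT lerNl -dotNl -(enormN x).
exact: dot_le_enorm.
Qed.

Lemma enormD x y : enorm (x + y) <= enorm x + enorm y.
Proof.
rewrite -(@ler_pXn2r _ 2)// ?nnegrE ?addr_ge0 ?enorm_ge0//.
rewrite enorm_sqr !dotE (dotC y x) sqrrD -!enorm_sqr.
have := dot_le_enorm x y; lra.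
Qed.

Lemma enorm_conv t x y z :
  enorm (t *: x + (1 - t) *: y - z) ^+ 2 =
  t * enorm (x - z) ^+ 2 + (1 - t) * enorm (y - z) ^+ 2
  - t * (1 - t) * enorm (x - y) ^+ 2.
Proof.
rewrite !enorm_sqr /dot !mulr_sumr -sumrN -!big_split/=.
by apply: eq_bigr => j _; rewrite !mxE; ring.
Qed.

Lemma enorm_conv0 t x y :
  enorm (t *: x + (1 - t) *: y) ^+ 2 =
  t * enorm x ^+ 2 + (1 - t) * enorm y ^+ 2
  - t * (1 - t) * enorm (x - y) ^+ 2.
Proof. by have := enorm_conv t x y 0; rewrite !subr0. Qed.

Lemma coord_le_norm x j : `|x 0 j| <= `|x|.
Proof.
rewrite [leRHS]/Num.norm/= mx_normrE; apply/bigmax_geP; right => /=.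
by exists (0, j).
Qed.

Lemma enorm_sqr_le_norm x : enorm x ^+ 2 <= n%:R * `|x| ^+ 2.
Proof.
rewrite enorm_sqr /dot (_ : n%:R * _ = \sum_(j < n) `|x| ^+ 2); last first.
  by rewrite sumr_const card_ord mulr_natl.
apply: ler_sum => j _; rewrite -expr2 -real_normK ?num_real//.
by rewrite lerXn2r ?nnegrE// coord_le_norm.
Qed.

Lemma norm_le_enorm x : `|x| <= enorm x.
Proof.
rewrite [leLHS]/Num.norm/= mx_normrE; apply/bigmax_leP; split.
  exact: enorm_ge0.
move=> [i j] _ /=; rewrite ord1 -(@ler_pXn2r _ 2)// ?nnegrE ?enorm_ge0//.
rewrite enorm_sqr /dot (bigD1 j)//= real_normK ?num_real// expr2 lerDl.
by apply: sumr_ge0 => k _; rewrite -expr2 sqr_ge0.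
Qed.

Lemma enorm_le_norm x : enorm x <= (n%:R + 1) * `|x|.
Proof.
rewrite -(@ler_pXn2r _ 2)// ?nnegrE ?enorm_ge0 ?mulr_ge0 ?addr_ge0//.
apply: (le_trans (enorm_sqr_le_norm x)); rewrite exprMn ler_wpM2r ?sqr_ge0//.
have : 0 <= n%:R :> R by []. nra.
Qed.

Lemma coord_dot (x : 'rV[R]_n) j : dot x (delta_mx 0 j) = x 0 j.
Proof.
rewrite /dot (bigD1 j)//= big1 ?addr0 ?mxE ?eqxx ?mulr1// => k kj.
by rewrite mxE (negbTE kj) andbF mulr0.
Qed.

(** Passage to the limit [t --> 0+] in an affine inequality. *)
Lemma ler_lim0 (A B M : R) :
  (forall t, 0 < t -> t <= 1 -> B <= A + t * M) -> B <= A.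
Proof.
move=> H; rewrite leNgt; apply/negP => AB.
have M0 : B - A <= M by have := H 1 ltr01 (lexx _); lra.
have Mp : 0 < M by lra.
have := H ((B - A) / (2 * M)).
have -> : (B - A) / (2 * M) * M = (B - A) / 2 by field; lra.
have -> : 0 < (B - A) / (2 * M) by rewrite divr_gt0; lra.
have -> : (B - A) / (2 * M) <= 1 by rewrite ler_pdivrMr; lra.
by move=> /(_ isT isT); lra.
Qed.

End Euclid.

(** * Convexity *)

Section Convexity.
Variables (R : realType) (n : nat).
Implicit Types (x y z : 'rV[R]_n) (D : set 'rV[R]_n) (h q : 'rV[R]_n -> R).

(** The convexity of [D] is included: [D] will be the domain of an extended-valued
    function and [q] its finite part, whose value outside [D] is meaningless. *)
Definition convex_on D q := forall x y (t : R), D x -> D y ->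
  0 <= t -> t <= 1 ->
  D (t *: x + (1 - t) *: y) /\
  q (t *: x + (1 - t) *: y) <= t * q x + (1 - t) * q y.

(** Compare the value at the minimiser [p] with the value at a point of the
    segment towards [y], and let that point tend to [p]. The result replaces the
    first-order optimality condition, for which [q] would need subgradients. *)
Lemma prox_growth D q (c : R) x p y : convex_on D q -> 0 <= c ->
  D p -> D y ->
  (forall z, D z ->
    q p + c * enorm (p - x) ^+ 2 <= q z + c * enorm (z - x) ^+ 2) ->
  q p + c * enorm (p - x) ^+ 2 + c * enorm (y - p) ^+ 2 <=
  q y + c * enorm (y - x) ^+ 2.
Proof.
move=> cq c0 Dp Dy pmin.
apply: (@ler_lim0 _ _ _ (c * enorm (y - p) ^+ 2)) => t t0 t1.
have [Dz qz] := cq y p t Dy Dp (ltW t0) t1.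
have := pmin _ Dz; rewrite enorm_conv => H.
rewrite -(ler_pM2l t0); nra.
Qed.

Lemma itv01 (t : R) : 0 <= t -> t <= 1 ->
  Itv.spec (@Itv.num_sem R) (Itv.Real `[0%Z, 1%Z]) t.
Proof. by move=> t0 t1; rewrite /= /Itv.num_sem/= num_real/= in_itv/= t0 t1. Qed.

Lemma convex_setP D x y (t : R) : convex_set D -> D x -> D y ->
  0 <= t -> t <= 1 -> D (t *: x + (1 - t) *: y).
Proof.
move=> cD Dx Dy t0 t1.
by have := cD x y (Itv.mk (itv01 t0 t1)); rewrite !inE => /(_ Dx Dy).
Qed.

Lemma weakly_convexP (rho : R) h : weakly_convex rho h <->
  (forall x y (t : R), 0 <= t -> t <= 1 ->
    h (t *: x + (1 - t) *: y) <=
    t * h x + (1 - t) * h y + rho / 2 * (t * (1 - t)) * enorm (x - y) ^+ 2).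
Proof.
split=> [wh x y t t0 t1|wh t x y _ _].
- have := wh (Itv.mk (itv01 t0 t1)) x y; rewrite !inE => /(_ I I).
  rewrite convRE /conv/= /unstable.onem -/(t *: x + (1 - t) *: y).
  rewrite enorm_conv0; lra.
- have := wh x y t%:num; rewrite ge0 le1 => /(_ isT isT).
  rewrite convRE /conv/= /unstable.onem; rewrite enorm_conv0; lra.
Qed.

End Convexity.

(** * Topology of the Euclidean space *)

Section Topology.
Variables (R : realType) (n : nat).
Implicit Types (x y z : 'rV[R]_n) (D : set 'rV[R]_n) (h q : 'rV[R]_n -> R).

Lemma near_enorm x (e : R) : 0 < e -> \forall z \near x, enorm (z - x) <= e.
Proof.
move=> e0; have n1 : 0 < n%:R + 1 :> R by rewrite ltr_wpDl.
have := nbhsx_ballx x _ (divr_gt0 e0 n1).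
apply: filterS => z; rewrite -ball_normE/= ltr_pdivlMr// mulrC => /ltW h.
by rewrite enormC (le_trans (enorm_le_norm _)).
Qed.

Lemma continuous_at_lipschitz (V : normedModType R) (k : 'rV[R]_n -> V) x (M : R) :
  (forall z, enorm (z - x) <= 1 -> `|k x - k z| <= M * enorm (z - x)) ->
  {for x, continuous k}.
Proof.
move=> kM; apply/(@cvgrPdist_le _ _ _ (nbhs x)) => e e0.
have M1 : 0 < `|M| + 1 by rewrite ltr_wpDl.
have := @filterI _ _ (nbhs_filter x) _ _ (near_enorm x ltr01)
  (near_enorm x (divr_gt0 e0 M1)).
apply: filterS => z [z1]; rewrite /= ler_pdivlMr// => ze.
apply: (le_trans (kM _ z1)); apply: le_trans ze.
rewrite mulrC ler_wpM2l ?enorm_ge0// (le_trans (ler_norm M))//; lra.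
Qed.

Lemma enorm_continuous x : continuous (fun z => enorm (z - x)).
Proof.
move=> z; apply: (@continuous_at_lipschitz _ _ _ 1) => w _.
rewrite mul1r ler_norml; apply/andP; split.
  have := enormD (w - z) (z - x); rewrite addrA subrK.
  by rewrite lerNl opprB lerBlDr.
have := enormD (z - w) (w - x); rewrite addrA subrK (enormC z w).
by rewrite lerBlDr.
Qed.

Lemma enorm_sqr_continuous x : continuous (fun z => enorm (z - x) ^+ 2).
Proof.
move=> z; apply: (@continuous_comp _ _ _ (fun z => enorm (z - x))
  (fun r : R => r ^+ 2)); first exact: enorm_continuous.
exact: exprn_continuous.
Qed.

Lemma enorm_bounded D x (M : R) :
  (forall z, D z -> enorm (z - x) <= M) -> bounded_set D.
Proof.
move=> DM; exists (`|x| + M); split; first exact: num_real.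
move=> N MN z Dz /=; rewrite -(subrK x z) (le_trans (ler_normD _ _))//.
have := DM _ Dz; have := norm_le_enorm (z - x); lra.
Qed.

Lemma locally_lipschitz_continuous h : locally_lipschitz h -> continuous h.
Proof.
move=> hl x; have [M M0 [[A B]/= [xA xB] AB]] := pinfty_ex_gt0 (hl x).
apply/(@cvgrPdist_le _ _ _ (nbhs x)) => e e0.
have := nbhsx_ballx x _ (divr_gt0 e0 M0) => xe.
near=> z; have := AB (x, z) => /=.
have Ax : A x by exact: nbhs_singleton.
have Bz : B z by near: z.
move=> /(_ (conj Ax Bz)); move/le_trans; apply.
rewrite mulrC -ler_pdivlMr//; apply: ltW.
suff : ball x (e / M) z by rewrite -ball_normE.
by near: z.
Unshelve. all: by end_near.
Qed.

(** The sublevel sets below the level [h y0] form a filter on a compact set, and a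
    cluster point of it lies in all of them. Only the sublevel sets within [D] are
    asked to be closed, so that [h] may be the finite part of an extended-valued
    function. *)
Lemma closed_sublevel_argmin D h y0 : D y0 ->
  (forall a, closed [set z | D z /\ h z <= a]) ->
  bounded_set [set z | D z /\ h z <= h y0] ->
  exists2 p, D p & forall z, D z -> h p <= h z.
Proof.
move=> Dy0 hcl hbd; set A := [set z | D z /\ h z <= h y0].
have Ay0 : A y0 by split.
have cA : compact A by apply: bounded_closed_compact => //; exact: hcl.
pose F := filter_from A (fun a => [set z | D z /\ h z <= h a]).
have FF : ProperFilter F.
  apply: filter_from_proper; last by move=> a [Da _]; exists a; split.
  apply: filter_from_filter; first by exists y0.
  move=> a b Aa Ab; have [ab|ba] := leP (h a) (h b).
    by exists a => // z [Dz za]; split; split=> //; exact: (le_trans za).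
  exists b => // z [Dz zb]; split; split=> //; apply: (le_trans zb).
  exact: ltW.
have FA : F A by exists y0.
have [p [[Dp pA] clp]] := cA F FF FA.
exists p => // z Dz; have [zy|yz] := leP (h z) (h y0); last first.
  by apply: (le_trans pA); exact: ltW.
have : closure [set u | D u /\ h u <= h z] p.
  by move=> B pB; apply: clp => //; exists z.
by rewrite -(closure_id _).1// => -[].
Qed.

Lemma exists_prox h x (c m : R) : continuous h -> 0 < c -> (forall z, m <= h z) ->
  exists p, forall z, h p + c * enorm (p - x) ^+ 2 <= h z + c * enorm (z - x) ^+ 2.
Proof.
move=> hc c0 hm; pose k z := h z + c * enorm (z - x) ^+ 2.
have kc : continuous k.
  move=> z; apply: (@cvgD _ _ _ (nbhs z) _ _ _ _ _ (hc z)).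
  by apply: cvgMl_tmp; exact: enorm_sqr_continuous.
have [||p _ pmin] := @closed_sublevel_argmin setT k x I.
- move=> a; rewrite (_ : [set _ | _] = k @^-1` [set z | z <= a]).
    by apply: preimage_closed => //; exact: closed_le.
  by apply/seteqP; split=> z //= -[].
- apply: (@enorm_bounded _ x (1 + (h x - m) / c)) => z [_].
  rewrite /k subrr enorm0 expr0n/= mulr0 addr0 => kz.
  have hq : enorm (z - x) ^+ 2 <= (h x - m) / c.
    by rewrite ler_pdivlMr// mulrC; have := hm z; lra.
  have := enorm_ge0 (z - x); nra.
- by exists p => z; exact: pmin.
Qed.

End Topology.

(** * Clarke subgradients of weakly convex functions *)

Section Clarke.
Variables (R : realType) (n : nat).
Implicit Types (x y z p g : 'rV[R]_n) (h : 'rV[R]_n -> R) (U : set 'rV[R]_n).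

(** For [t <= 1], weak convexity on the segment from [x'] to [x' + v] bounds the
    difference quotient at [x'] in direction [v] by
    [h (x' + v) - h x' + rho / 2 * |v|^2]; continuity lets [x'] tend to [x]. *)
Lemma clarke_subgradient (rho : R) h x g y : 0 <= rho ->
  continuous h -> weakly_convex rho h -> clarke_subdiff h x g ->
  h x + dot g (y - x) - rho / 2 * enorm (y - x) ^+ 2 <= h y.
Proof.
move=> rho0 hc /weakly_convexP wh /(_ (y - x)) hg; set v := y - x in hg *.
apply/ler_addgt0Pr => e e0.
suff H : (clarke_dd h x v <= (h y - h x + rho / 2 * enorm v ^+ 2 + e)%:E)%E.
  by have := le_trans hg H; rewrite lee_fin; lra.
apply: ge_ereal_inf; set b := (_ + e).
have kc : continuous (fun z => h (z + v) - h z).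
  move=> z; apply: (@cvgB _ _ _ (nbhs z) _ _ _ _ _ _ (hc z)).
  apply: (@continuous_comp _ _ _ (fun z => z + v) h); last exact: hc.
  exact: (@cvgD _ _ _ (nbhs z) _ id (cst v) _ _ cvg_id (cvg_cst _)).
exists (ereal_sup [set ((h (p.1 + p.2 *: v) - h p.1) / p.2)%:E | p in
  [set z | h (z + v) - h z <= h y - h x + e] `*` [set t : R | 0 < t /\ t <= 1]]).
- eexists; last by [].
  exists ([set z | h (z + v) - h z <= h y - h x + e],
    [set t : R | 0 < t /\ t <= 1]) => //.
  split => /=; last by apply: filterI; [exact: nbhs_right_gt|exact: nbhs_right_le].
  by apply: (cvgr_le _ (kc x)); rewrite (addrC x) subrK ltrDl.
- apply: ge_ereal_sup => _ [[z t]/= [hz [t0 t1]] <-]; rewrite lee_fin ler_pdivrMr//.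
  have := wh (z + v) z t (ltW t0) t1.
  have -> : t *: (z + v) + (1 - t) *: z = z + t *: v.
    by apply/rowP => j; rewrite !mxE; ring.
  rewrite [z + v - z]addrAC subrr add0r.
  have := sqr_ge0 (enorm v); set N := enorm v ^+ 2 => N0.
  have : 0 <= rho * N * t ^+ 2 by exact: mulr_ge0 (mulr_ge0 rho0 N0) (sqr_ge0 t).
  move=> H1 H2; rewrite /b -/N.
  have : t * (h (z + v) - h z) <= t * (h y - h x + e) by rewrite ler_pM2l.
  lra.
Qed.

(** A minimiser [p] of [h + c |. - x|^2] satisfies
    [h (p + w) >= h p + <2 c (x - p), w> - c |w|^2], so the difference quotients
    at [p] itself already witness that [2 c (x - p)] is a Clarke subgradient. *)
Lemma prox_clarke h x p (c : R) : 0 <= c ->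
  (forall z, h p + c * enorm (p - x) ^+ 2 <= h z + c * enorm (z - x) ^+ 2) ->
  clarke_subdiff h p ((2 * c) *: (x - p)).
Proof.
move=> c0 pmin v; apply: le_ereal_inf_tmp => _ [V [[A B]/= [pA B0] ABV] <-].
apply/lee_addgt0Pr => e e0.
have [t [Bt [t0 te]]] : exists t, B t /\ 0 < t /\ t * (c * enorm v ^+ 2) <= e.
  have cv0 : 0 <= c * enorm v ^+ 2 by rewrite mulr_ge0// sqr_ge0.
  have d0 : 0 < e / (c * enorm v ^+ 2 + 1) by rewrite divr_gt0// ltr_wpDl.
  near (0 : R)^'+ => t.
  exists t; split; first by near: t.
  have t0 : 0 < t by near: t; exact: nbhs_right_gt.
  split => //.
  have : t <= e / (c * enorm v ^+ 2 + 1) by near: t; exact: nbhs_right_le.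
  rewrite ler_pdivlMr ?ltr_wpDl// => h1; apply: le_trans h1.
  by rewrite ler_pM2l// lerDl.
have Ap : A p by exact: nbhs_singleton.
apply: (@le_trans _ _ (((h (p + t *: v) - h p) / t)%:E + e%:E)); last first.
  by rewrite leeD2r//; apply: ereal_sup_ubound; exists (p, t) => //; exact: ABV.
rewrite -EFinD lee_fin -lerBlDr ler_pdivlMr//.
have := pmin (p + t *: v).
have -> : enorm (p + t *: v - x) ^+ 2 =
    enorm (p - x) ^+ 2 + 2 * t * dot (p - x) v + t ^+ 2 * enorm v ^+ 2.
  rewrite !enorm_sqr (addrAC p) [in LHS]dotDl !(dotDr (p - x)) !dotE.
  by rewrite (dotC v p) (dotC v x) (dotC x p); ring.
rewrite -(opprB p x) dotZl dotNl.
have : t * (t * (c * enorm v ^+ 2)) <= t * e by rewrite ler_pM2l.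
lra.
Unshelve. all: by end_near.
Qed.

Lemma nbhs_enorm x (A : set 'rV[R]_n) : nbhs x A ->
  exists2 e, 0 < e & forall z, enorm (z - x) <= e -> A z.
Proof.
move=> /nbhs_ballP[e /= e0 eA]; exists (e / 2); first exact: divr_gt0.
move=> z ze; apply: eA; rewrite -ball_normE/= -normrN opprB.
by rewrite (le_lt_trans (norm_le_enorm _))// (le_lt_trans ze)// ltr_pdivrMr//; lra.
Qed.

(** Proximal points [p] of [h] with a large parameter [c] are close to [x], hence
    in [U], and carry a Clarke subgradient: so the estimate holds at points
    arbitrarily close to [x] and is continuous there. This spares the existence
    of a subgradient at [x] itself. *)
Lemma clarke_lipschitz_quad (rho m G : R) h U x y : 0 <= rho -> open U -> U x ->
  continuous h -> weakly_convex rho h -> (forall z, m <= h z) ->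
  (forall z g, U z -> clarke_subdiff h z g -> enorm g <= G) ->
  h x <= h y + G * enorm (y - x) + rho / 2 * enorm (y - x) ^+ 2.
Proof.
move=> rho0 oU Ux hc wh hm hG; apply/ler_addgt0Pr => e e0.
pose k z := h z - G * enorm (z - y) - rho / 2 * enorm (z - y) ^+ 2.
have kc : continuous k.
  move=> z; apply: (@cvgB _ _ _ (nbhs z)); last first.
    by apply: cvgMl_tmp; exact: enorm_sqr_continuous.
  apply: (@cvgB _ _ _ (nbhs z) _ _ _ _ _ (hc z)).
  by apply: cvgMl_tmp; exact: enorm_continuous.
have : nbhs x (U `&` [set z | k x - e < k z]).
  by apply: filterI; [exact: open_nbhs_nbhs|apply: (cvgr_gt _ (kc x)); lra].
move=> /nbhs_enorm[d d0 dx].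
(* A minimiser [p] satisfies [c |p - x|^2 <= h x - m], so [|p - x| <= d]. *)
pose c := (h x - m + 1) / d ^+ 2.
have d20 : 0 < d ^+ 2 by rewrite exprn_gt0.
have hxm := hm x.
have c0 : 0 < c by rewrite divr_gt0//; lra.
have [p pmin] := exists_prox x hc c0 hm.
have pd : enorm (p - x) <= d.
  have := pmin x; rewrite subrr enorm0 expr0n/= mulr0 addr0.
  have := hm p => mp px.
  rewrite -(@ler_pXn2r _ 2)// ?nnegrE ?enorm_ge0 ?(ltW d0)//.
  have : c * enorm (p - x) ^+ 2 <= c * d ^+ 2.
    rewrite [leRHS](_ : _ = h x - m + 1); first lra.
    by rewrite /c divfK// gt_eqF.
  by rewrite ler_pM2l.
have [Up kp] := dx _ pd.
have gp := prox_clarke (ltW c0) pmin.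
have := clarke_subgradient y rho0 hc wh gp.
have := hG _ _ Up gp => gG.
have := dot_le_enorm (- ((2 * c) *: (x - p))) (y - p).
rewrite dotNl enormN.
have := ler_wpM2r (enorm_ge0 (y - p)) gG.
move: kp; rewrite /k/= (enormC p y) (enormC x y); lra.
Qed.

(** Cut the segment into [N] pieces: the quadratic error is of order [1 / N]. *)
Lemma clarke_lipschitz (rho m G : R) h U x y : 0 <= rho ->
  open U -> convex_set U -> U x -> U y ->
  continuous h -> weakly_convex rho h -> (forall z, m <= h z) ->
  (forall z g, U z -> clarke_subdiff h z g -> enorm g <= G) ->
  h x <= h y + G * enorm (y - x).
Proof.
move=> rho0 oU cU Ux Uy hc wh hm hG.
set D := enorm (y - x).
have step N : h x <= h y + G * D + N.+1%:R^-1 * (rho / 2 * D ^+ 2).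
  pose t i : R := i%:R / N.+1%:R.
  pose z i := t i *: y + (1 - t i) *: x.
  have N0 : 0 < N.+1%:R :> R by [].
  have Uz i : (i <= N.+1)%N -> U (z i).
    move=> iN; apply: convex_setP => //; first by rewrite divr_ge0.
    by rewrite ler_pdivrMr// mul1r ler_nat.
  have zS i : enorm (z i.+1 - z i) = N.+1%:R^-1 * D.
    rewrite (_ : z i.+1 - z i = N.+1%:R^-1 *: (y - x)).
      by rewrite enormZ ger0_norm.
    rewrite /z /t; apply/rowP => j; rewrite !mxE -natr1; field.
    by rewrite addrC natr1 gt_eqF.
  have H i : (i <= N.+1)%N ->
      h x <= h (z i) + i%:R * (G * (N.+1%:R^-1 * D) + rho / 2 * (N.+1%:R^-1 * D) ^+ 2).
    elim: i => [_|i IH iN].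
      by rewrite mul0r addr0 /z /t mul0r subr0 scale0r add0r scale1r.
    apply: (le_trans (IH (ltnW iN))).
    have := clarke_lipschitz_quad (z i.+1) rho0 oU (Uz _ (ltnW iN)) hc wh hm hG.
    rewrite zS -natr1; lra.
  have := H N.+1 (leqnn _).
  rewrite {1}/z /t divff ?gt_eqF// subrr scale0r addr0 scale1r.
  move/le_trans; apply; rewrite -addrA lerD2l le_eqVlt; apply/orP; left.
  apply/eqP; field.
  by rewrite addrC natr1 gt_eqF.
apply: (@ler_lim0 _ _ _ (rho / 2 * D ^+ 2)) => u u0 u1.
have /= := truncnS_gt u^-1 => /ltW uN.
apply: (le_trans (step (Num.truncn u^-1))).
rewrite lerD2l ler_wpM2r//; first by rewrite mulr_ge0 ?sqr_ge0// divr_ge0.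
by rewrite invf_ple ?posrE.
Qed.

End Clarke.

(** * The Moreau envelope of a weakly convex function *)

Section MoreauEnvelope.
Variables (R : realType) (n : nat).
Implicit Types (x y z p : 'rV[R]_n).
Variables (D : set 'rV[R]_n) (q : 'rV[R]_n -> R) (rho : R).
Hypothesis rho_gt0 : 0 < rho.
Hypothesis q_wconvex :
  forall x, convex_on D (fun y => q y + rho / 2 * enorm (y - x) ^+ 2).

Definition is_prox x p := D p /\ forall z, D z ->
  q p + rho * enorm (p - x) ^+ 2 <= q z + rho * enorm (z - x) ^+ 2.

Variable prox : 'rV[R]_n -> 'rV[R]_n.
Hypothesis proxP : forall x, is_prox x (prox x).

Definition menv x := q (prox x) + rho * enorm (prox x - x) ^+ 2.

(** Half of the quadratic term makes [q] convex, the other half is strongly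
    convex. *)
Lemma menv_growth x z : D z ->
  menv x + rho / 2 * enorm (z - prox x) ^+ 2 <= q z + rho * enorm (z - x) ^+ 2.
Proof.
move=> Dz; have [Dp pmin] := proxP x; rewrite /menv.
have r2 : 0 <= rho / 2 by rewrite divr_ge0// ltW.
have H w : D w ->
    (q (prox x) + rho / 2 * enorm (prox x - x) ^+ 2)
      + rho / 2 * enorm (prox x - x) ^+ 2 <=
    (q w + rho / 2 * enorm (w - x) ^+ 2) + rho / 2 * enorm (w - x) ^+ 2.
  by move=> Dw; have := pmin _ Dw; lra.
have := prox_growth (q_wconvex x) r2 Dp Dz H; lra.
Qed.

Lemma menv_le x z : D z -> menv x <= q z + rho * enorm (z - x) ^+ 2.
Proof. exact: (proxP x).2. Qed.

(** Add up the growth inequalities at [x] and [y]. *)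
Lemma prox_lipschitz x y : enorm (prox y - prox x) <= 2 * enorm (y - x).
Proof.
have := menv_growth x (proxP y).1; have := menv_growth y (proxP x).1.
rewrite /menv (enormC (prox x) (prox y)) => H1 H2.
have H : rho * enorm (prox y - prox x) ^+ 2 <=
    rho * (2 * dot (prox y - prox x) (y - x)).
  have -> : 2 * dot (prox y - prox x) (y - x) =
      enorm (prox y - x) ^+ 2 + enorm (prox x - y) ^+ 2
      - enorm (prox x - x) ^+ 2 - enorm (prox y - y) ^+ 2.
    rewrite !enorm_sqr /dot mulr_sumr -!sumrN -!big_split/=.
    by apply: eq_bigr => j _; rewrite !mxE; ring.
  lra.
rewrite ler_pM2l// in H.
have := dot_le_enorm (prox y - prox x) (y - x).
have := enorm_ge0 (prox y - prox x); have := enorm_ge0 (y - x); nra.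
Qed.

Lemma menv_upper x v :
  menv (x + v) <= menv x + dot ((2 * rho) *: (x - prox x)) v + rho * enorm v ^+ 2.
Proof.
apply: (le_trans (menv_le (x + v) (proxP x).1)); rewrite /menv le_eqVlt.
apply/orP; left; apply/eqP; rewrite !enorm_sqr /dot !mulr_sumr -!addrA.
rewrite -!big_split/=; congr (_ + _); apply: eq_bigr => j _.
by rewrite !mxE; ring.
Qed.

(** The upper bound at [x + v] in direction [- v], where [prox (x + v)] is traded
    for [prox x]. *)
Lemma menv_lower x v :
  menv x + dot ((2 * rho) *: (x - prox x)) v - 3 * rho * enorm v ^+ 2 <=
  menv (x + v).
Proof.
have := menv_upper (x + v) (- v); rewrite addrK enormN dotNr.
have -> : dot ((2 * rho) *: (x + v - prox (x + v))) v =
  dot ((2 * rho) *: (x - prox x)) v + 2 * rho * enorm v ^+ 2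
  - 2 * rho * dot (prox (x + v) - prox x) v.
  rewrite enorm_sqr /dot !mulr_sumr -sumrN -!big_split/=.
  by apply: eq_bigr => j _; rewrite !mxE; ring.
have := dot_le_enorm (prox (x + v) - prox x) v.
have := prox_lipschitz x (x + v); rewrite addrAC subrr add0r => H1 H2.
have : dot (prox (x + v) - prox x) v <= 2 * enorm v * enorm v.
  by apply: (le_trans H2); rewrite ler_wpM2r// enorm_ge0.
rewrite -(ler_pM2l rho_gt0); lra.
Qed.

(** [menv_upper] and [menv_lower] leave a remainder that is quadratic in the
    increment. *)
Lemma gradient_menv x : gradient menv x = (2 * rho) *: (x - prox x).
Proof.
set g := (2 * rho) *: (x - prox x).
pose l : 'rV[R]_n -> R^o := dot g.
have ll : linear l by move=> a u v; rewrite /l dotDr dotZr.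
pose L : {linear 'rV[R]_n -> R^o} :=
  HB.pack l (GRing.isLinear.Build _ _ _ _ l ll).
have lc : continuous L.
  move=> z; apply: (@continuous_at_lipschitz _ _ _ _ _ (enorm g)) => w _.
  rewrite -[L z - L w]/(dot g z - dot g w) -dotNr -dotDr enormC.
  exact: normr_dot.
suff E : 'd (menv : 'rV[R]_n -> R^o) x = L :> ('rV[R]_n -> R^o).
  by apply/rowP => j; rewrite mxE E [LHS]coord_dot.
apply: diff_unique => //; apply/eqaddoP => e e0.
(* Differentials refer to the max-norm, whence the factor [n]. *)
pose B := 3 * rho * n%:R + 1.
have B0 : 0 < B by rewrite ltr_wpDl// mulr_ge0// mulr_ge0// ltW.
have := nbhsx_ballx (0 : 'rV[R]_n) _ (divr_gt0 e0 B0); apply: filterS => v.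
rewrite -ball_normE/= sub0r normrN ltr_pdivlMr// => /ltW vB.
rewrite -[X in `|X|]/(menv (v + x) - (menv x + dot g v)) (addrC v x).
have := menv_upper x v; have := menv_lower x v; rewrite -/g.
have := enorm_sqr_le_norm v => H1 H2 H3.
have H4 : 3 * rho * enorm v ^+ 2 <= e * `|v|.
  apply: (@le_trans _ _ (3 * rho * (n%:R * `|v| ^+ 2))).
    by rewrite ler_pM2l ?mulr_gt0.
  apply: (@le_trans _ _ (`|v| * B * `|v|)).
    by rewrite /B; have := sqr_ge0 `|v|; lra.
  by rewrite ler_wpM2r.
have : 0 <= rho * enorm v ^+ 2 by rewrite mulr_ge0 ?sqr_ge0// ltW.
by move=> H5; rewrite ler_norml; apply/andP; split; lra.
Qed.

Lemma continuous_menv : continuous menv.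
Proof.
move=> x; set g := (2 * rho) *: (x - prox x).
apply: (@continuous_at_lipschitz _ _ _ _ _ (enorm g + 3 * rho)) => z z1.
have := menv_upper x (z - x); have := menv_lower x (z - x).
rewrite (addrC x (z - x)) subrK -/g => H1 H2.
have := normr_dot g (z - x); rewrite ler_norml => /andP[H3 H4].
have : rho * enorm (z - x) ^+ 2 <= rho * enorm (z - x).
  by rewrite ler_pM2l// expr2 ler_piMl// enorm_ge0.
have : 0 <= rho * enorm (z - x) ^+ 2 by rewrite mulr_ge0 ?sqr_ge0// ltW.
by move=> H5 H6; rewrite ler_norml; apply/andP; split; lra.
Qed.

Lemma continuous_prox : continuous prox.
Proof.
move=> x; apply: (@continuous_at_lipschitz _ _ _ _ _ 2) => z _.
by rewrite -normrN opprB (le_trans (norm_le_enorm _))// prox_lipschitz.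
Qed.

Definition prox_dist x := enorm (x - prox x) ^+ 2.

Lemma continuous_prox_dist : continuous prox_dist.
Proof.
rewrite /prox_dist.
under eq_fun => z do rewrite -[z - prox z]subr0.
move=> x; apply: (@continuous_comp _ _ _ (fun z => z - prox z)
  (fun z => enorm (z - 0) ^+ 2) x); last exact: enorm_sqr_continuous.
by apply: continuousB; [exact: cvg_id|exact: continuous_prox].
Qed.

End MoreauEnvelope.

(** * Proximal points of a composite objective *)

Section Composite.
Variables (R : realType) (n : nat).
Implicit Types (x y z : 'rV[R]_n).
Variables (phi : 'rV[R]_n -> \bar R) (F : 'rV[R]_n -> R) (U : set 'rV[R]_n).
Hypotheses (phi_proper : eproper phi) (phi_closed : closed_fun phi).

Let D := edom phi.
Let phir := fine \o phi.

Lemma edom_fineK y : D y -> (phir y)%:E = phi y.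
Proof.
rewrite /D /phir /edom/= => yoo; apply: fineK.
by rewrite fin_numE phi_proper.1 lt_eqF.
Qed.

Lemma edomP y (a : R) : (phi y <= a%:E)%E -> D y /\ phir y <= a.
Proof.
move=> ya; have Dy : D y by exact: (le_lt_trans ya (ltry a)).
by split=> //; rewrite -lee_fin edom_fineK.
Qed.

Lemma strongly_convex_on (lambda : R) : 0 <= lambda ->
  strongly_convex lambda phi -> convex_on D phir.
Proof.
move=> l0 sc x y t Dx Dy t0 t1.
have := sc x y t t0 t1; rewrite /= -(edom_fineK Dx) -(edom_fineK Dy) enorm_conv0.
set N := (X in t * (1 - t) * X).
have N0 : 0 <= N by exact: sqr_ge0.
set z := t *: x + (1 - t) *: y.
rewrite EFinN leeBlDr//.
rewrite (_ : (_ + _ + _)%E = (t * (phir x - lambda / 2 * enorm x ^+ 2) +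
  (1 - t) * (phir y - lambda / 2 * enorm y ^+ 2) + lambda / 2 *
    (t * enorm x ^+ 2 + (1 - t) * enorm y ^+ 2 - t * (1 - t) * N))%:E)//.
move=> /edomP[Dz H].
split => //; apply: (le_trans H).
have : 0 <= lambda * (t * (1 - t) * N).
  by apply: mulr_ge0 => //; apply: mulr_ge0 => //; apply: mulr_ge0 => //; lra.
lra.
Qed.

Variables (rho L : R).
Hypotheses (rho_gt0 : 0 < rho) (L_ge0 : 0 <= L).
Hypothesis dom_U : D `<=` U.
Hypothesis F_lip : forall x y, U x -> U y -> F x <= F y + L * enorm (y - x).
Hypothesis F_wconvex : weakly_convex rho F.
Hypothesis phi_convex : convex_on D phir.

Definition composite y := F y + phir y.

Lemma composite_wconvex x :
  convex_on D (fun y => composite y + rho / 2 * enorm (y - x) ^+ 2).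
Proof.
move=> y z t Dy Dz t0 t1; have [Dw Hp] := phi_convex Dy Dz t0 t1; split=> //.
have := (weakly_convexP rho F).1 F_wconvex y z t t0 t1.
rewrite enorm_conv /composite; lra.
Qed.

Lemma closed_sublevel_phi (M : R) : closed [set z | (phi z <= M%:E)%E].
Proof.
rewrite (_ : [set z | _] = (fun z => (z, M)) @^-1` [set p | (phi p.1 <= p.2%:E)%E]) //.
apply: preimage_closed => //.
move=> z _; exact: (@cvg_pair _ _ _ (nbhs z) (nbhs z) (nbhs M) _ _ _ id (cst M)
  cvg_id (cvg_cst M)).
Qed.

(** The argument uses the continuity of [F] on [U] alone. On a bounded part of the
    sublevel set, the Lipschitz bound turns the sublevel inequality into
    a uniform upper bound on [phi]; so a limit point lies in the domain of [phi],
    hence in [U]. *)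
Lemma closed_sublevel_composite x a :
  closed [set z | D z /\ composite z + rho * enorm (z - x) ^+ 2 <= a].
Proof.
set S := [set z | _]; move=> y clS.
have lim M : (\forall z \near y, S z -> (phi z <= M%:E)%E) -> (phi y <= M%:E)%E.
  move=> yM; have : closure [set z | (phi z <= M%:E)%E] y.
    move=> B yB; have [z [Sz [Bz zM]]] := clS _ (filterI yB yM).
    by exists z; split => //=; exact: zM.
  by rewrite -(closure_id _).1//; exact: closed_sublevel_phi.
have [y0 Dy0] := phi_proper.2.
have Dy : D y.
  apply: (@edomP _ (a - F y0 + L * (enorm (y - y0) + 1)) _).1.
  apply: lim; have := near_enorm y ltr01; apply: filterS => z zy [Dz].
  rewrite /composite -edom_fineK// lee_fin.
  have := F_lip (dom_U Dy0) (dom_U Dz).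
  have : 0 <= rho * enorm (z - x) ^+ 2 by rewrite mulr_ge0 ?sqr_ge0// ltW.
  have : L * enorm (z - y0) <= L * (enorm (y - y0) + 1).
    rewrite ler_wpM2l// -(subrK y z) -addrA (le_trans (enormD _ _))//; lra.
  lra.
split=> //; apply/ler_addgt0Pr => e e0.
suff : (phi y <= (a - F y - rho * enorm (y - x) ^+ 2 + e)%:E)%E.
  by rewrite -edom_fineK// lee_fin /composite; lra.
apply: lim; have e2 : 0 < e / 2 by exact: divr_gt0.
have L1 : 0 < L + 1 by rewrite ltr_wpDl.
pose k (z : 'rV[R]_n) : R := rho * enorm (z - x) ^+ 2.
have kc : continuous k.
  move=> z; apply: (@cvgMl_tmp _ _ (nbhs z)).
  exact: enorm_sqr_continuous.
have : \forall z \near y, rho * enorm (y - x) ^+ 2 - e / 2 < k z.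
  by apply: (cvgr_gt _ (kc y)); rewrite ltrBlDr ltrDl.
have := near_enorm y (divr_gt0 e2 L1).
apply: filterS2 => z; rewrite ler_pdivlMr// => zy zx [Dz].
rewrite /composite -edom_fineK// lee_fin.
have := F_lip (dom_U Dy) (dom_U Dz); have := enorm_ge0 (z - y).
move: zx; rewrite /k/=; lra.
Qed.

Lemma composite_prox (m : R) x : (forall y, D y -> m <= composite y) ->
  exists p, is_prox D composite rho x p.
Proof.
move=> qm; have [y0 Dy0] := phi_proper.2.
have [||p Dp pmin] := @closed_sublevel_argmin _ _ D
  (fun z => composite z + rho * enorm (z - x) ^+ 2) y0 Dy0; last by exists p.
- exact: closed_sublevel_composite.
- pose a := composite y0 + rho * enorm (y0 - x) ^+ 2.
  apply: (@enorm_bounded _ _ _ x (1 + (a - m) / rho)) => z [Dz]; rewrite -/a => za.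
  have hq : enorm (z - x) ^+ 2 <= (a - m) / rho.
    by rewrite ler_pdivlMr// mulrC; have := qm _ Dz; lra.
  have := enorm_ge0 (z - x); nra.
Qed.

Variable prox : 'rV[R]_n -> 'rV[R]_n.
Hypothesis proxP : forall x, is_prox D composite rho x (prox x).

Lemma env_composite x :
  env (1 / (2 * rho)) (fun y => (F y)%:E + phi y)%E x =
  (menv composite rho prox x)%:E.
Proof.
have rhoE : 1 / (2 * (1 / (2 * rho))) = rho by field; rewrite gt_eqF.
rewrite /env rhoE /emin; apply/eqP; rewrite eq_le; apply/andP; split.
  apply: ge_ereal_inf; eexists; first by exists (prox x).
  by rewrite -(edom_fineK (proxP x).1).
apply: le_ereal_inf_tmp => _ [y _ <-].
have [yoo|] := ltP (phi y) +oo%E.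
  by rewrite -(edom_fineK yoo) -!EFinD lee_fin; exact: (proxP x).2.
by rewrite leye_eq => /eqP ->; rewrite addey// addye// leey.
Qed.

End Composite.

(** * Expectations of real random variables *)

Section RealExpectation.
Context d (T : measurableType d) (R : realType) (P : probability T R).
Implicit Types (X Y : T -> R) (c : R).

Definition L1 X := P.-integrable setT (fun w => (X w)%:E).

(** [mean_fun P f x] is convertible to [mean P (f ^~ x)]. *)
Definition mean X : R := fine ('E_P[X])%E.

Lemma meanE X : mean X = (\int[P]_w X w)%R.
Proof. by rewrite /mean unlock. Qed.

Lemma mean_EFin X : L1 X -> ('E_P[X])%E = (mean X)%:E.
Proof. by move=> iX; rewrite /mean unlock fineK//; exact: integrable_fin_num. Qed.

Lemma L1_measurable X : L1 X -> measurable_fun setT X.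
Proof. by move=> /integrableP[/measurable_EFinP]. Qed.

Lemma L1_cst c : L1 (fun=> c).
Proof. exact: finite_measure_integrable_cst. Qed.

Lemma L1D X Y : L1 X -> L1 Y -> L1 (fun w => X w + Y w).
Proof. by move=> iX iY; exact: (integrableD measurableT iX iY). Qed.

Lemma L1B X Y : L1 X -> L1 Y -> L1 (fun w => X w - Y w).
Proof. by move=> iX iY; exact: (integrableB measurableT iX iY). Qed.

Lemma L1Z c X : L1 X -> L1 (fun w => c * X w).
Proof. by move=> iX; exact: (integrableZl measurableT c iX). Qed.

Lemma L1_sum (I : Type) (s : seq I) (X : I -> T -> R) :
  (forall i, L1 (X i)) -> L1 (fun w => \sum_(i <- s) X i w).
Proof.
move=> iX; elim: s => [|i s IH].
  by under [X in L1 X]eq_fun do rewrite big_nil; exact: L1_cst.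
by under [X in L1 X]eq_fun do rewrite big_cons; exact: L1D.
Qed.

Lemma L1_le X Y : measurable_fun setT X -> (forall w, `|X w| <= Y w) ->
  L1 Y -> L1 X.
Proof.
move=> mX XY; apply: le_integrable => //; first exact/measurable_EFinP.
by move=> w _ /=; rewrite lee_fin (le_trans (XY w))// ler_norm.
Qed.

Lemma meanD X Y : L1 X -> L1 Y -> mean (fun w => X w + Y w) = mean X + mean Y.
Proof. by move=> iX iY; rewrite !meanE RintegralD. Qed.

Lemma meanB X Y : L1 X -> L1 Y -> mean (fun w => X w - Y w) = mean X - mean Y.
Proof. by move=> iX iY; rewrite !meanE RintegralB. Qed.

Lemma meanZ c X : L1 X -> mean (fun w => c * X w) = c * mean X.
Proof. by move=> iX; rewrite !meanE RintegralZl. Qed.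

Lemma mean_cst c : mean (fun=> c) = c.
Proof. by rewrite meanE Rintegral_cst//= probability_setT mulr1. Qed.

Lemma mean_sum (I : Type) (s : seq I) (X : I -> T -> R) :
  (forall i, L1 (X i)) ->
  mean (fun w => \sum_(i <- s) X i w) = \sum_(i <- s) mean (X i).
Proof.
move=> iX; elim: s => [|i s IH].
  by rewrite big_nil; under [X in mean X]eq_fun do rewrite big_nil; exact: mean_cst.
rewrite big_cons -IH; under [X in mean X]eq_fun do rewrite big_cons.
by rewrite meanD//; exact: L1_sum.
Qed.

Lemma mean_le X Y : L1 X -> L1 Y -> (forall w, X w <= Y w) -> mean X <= mean Y.
Proof. by move=> iX iY XY; rewrite !meanE le_Rintegral. Qed.

Lemma mean_ge0 X : (forall w, 0 <= X w) -> 0 <= mean X.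
Proof. by move=> X0; rewrite meanE Rintegral_ge0. Qed.

Lemma mean_gt0 X : L1 X -> (forall w, 0 < X w) -> 0 < mean X.
Proof.
move=> iX X0; rewrite lt_neqAle mean_ge0 ?andbT => [|w]; last exact: ltW.
apply/eqP => m0.
have [+ _] := ae_eq_integral_abs P measurableT (measurable_int P iX).
under eq_integral => w _ do rewrite /= ger0_norm ?(ltW (X0 w))//.
have := mean_EFin iX; rewrite -m0 unlock => -> /(_ erefl) [A [mA A0 XA]].
have : (P setT <= P A)%E.
  apply: le_measure; rewrite ?inE// => w _; apply: XA => /= /(_ I) [] Xw0.
  by have := X0 w; rewrite Xw0 ltxx.
by rewrite A0 probability_setT lee_fin ler10.
Qed.

Lemma L1_square X : measurable_fun setT X -> L1 (fun w => X w ^+ 2) -> L1 X.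
Proof.
move=> mX iX; apply: (@L1_le _ (fun w => 1 + X w ^+ 2)) => //; last first.
  by apply: L1D => //; exact: L1_cst.
by move=> w; rewrite -real_normK ?num_real//; have := sqr_ge0 (`|X w| - 1); nra.
Qed.

(** The variance is nonnegative. *)
Lemma mean_square X : measurable_fun setT X -> L1 (fun w => X w ^+ 2) ->
  mean X ^+ 2 <= mean (fun w => X w ^+ 2).
Proof.
move=> mX iX2; have iX := L1_square mX iX2.
have := mean_ge0 (fun w => sqr_ge0 (X w - mean X)).
rewrite (_ : (fun w => (X w - mean X) ^+ 2) =
  (fun w => (X w ^+ 2 - (2 * mean X) * X w) + mean X ^+ 2)); last first.
  by apply/funext => w; ring.
have iZ : L1 (fun w => (2 * mean X) * X w) by exact: L1Z.
rewrite meanD ?mean_cst; last 2 first.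
- exact: L1B.
- exact: L1_cst.
rewrite meanB// meanZ//; lra.
Qed.

End RealExpectation.

Section MeanFunction.
Context d (T : measurableType d) (R : realType) (P : probability T R) (n : nat).
Variable f : T -> 'rV[R]_n -> R.
Hypothesis f_int : forall x, L1 P (fun s => f s x).

Lemma mean_fun_wconvex (rhos : T -> R) : L1 P rhos ->
  (forall s, weakly_convex (rhos s) (f s)) ->
  weakly_convex (mean P rhos) (mean_fun P f).
Proof.
move=> irho wf; apply/weakly_convexP => x y t t0 t1.
rewrite -![mean_fun P f _]/(mean P (fun s => f s _)).
set c := 2^-1 * (t * (1 - t)) * enorm (x - y) ^+ 2.
rewrite (_ : _ * _ * _ = c * mean P rhos); last by rewrite /c; lra.
have i1 : L1 P (fun s => t * f s x) by exact: L1Z.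
have i2 : L1 P (fun s => (1 - t) * f s y) by exact: L1Z.
have i3 : L1 P (fun s => c * rhos s) by exact: L1Z.
have i12 := L1D i1 i2.
rewrite -!meanZ// -!meanD//; apply: mean_le => //; first exact: (L1D i12 i3).
move=> s; have := (weakly_convexP _ _).1 (wf s) x y t t0 t1.
rewrite /c; lra.
Qed.

Lemma mean_fun_lipschitz (Gs : T -> R) x y : L1 P Gs ->
  (forall s, f s x <= f s y + Gs s * enorm (y - x)) ->
  mean_fun P f x <= mean_fun P f y + mean P Gs * enorm (y - x).
Proof.
move=> iG fl; rewrite -![mean_fun P f _]/(mean P (fun s => f s _)).
rewrite mulrC -meanZ// -meanD//; last exact: L1Z.
apply: mean_le => //; first by apply: L1D => //; exact: L1Z.
by move=> s; rewrite (mulrC (enorm _)).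
Qed.

End MeanFunction.

(** * Measurability of Caratheodory integrands *)

Section Caratheodory.
Variables (R : realType) (n : nat).

Definition rounding (m : nat) (v : 'rV[R]_n) : 'rV[int]_n :=
  \row_j Num.floor (m.+1%:R * v 0 j).

Definition grid (m : nat) (z : 'rV[int]_n) : 'rV[R]_n :=
  \row_j ((z 0 j)%:~R / m.+1%:R).

Lemma grid_rounding m (v : 'rV[R]_n) j :
  `|(v - grid m (rounding m v)) 0 j| <= m.+1%:R^-1.
Proof.
rewrite !mxE; set a := m.+1%:R; have a0 : 0 < a by rewrite ltr0n.
have fl := floor_le (a * v 0 j); have fg := lt_succ_floor (a * v 0 j).
rewrite -(ler_pM2l a0) -{1}(gtr0_norm a0) -normrM mulrBr.
rewrite (mulrC a (_ / _)) divfK ?gt_eqF// divff ?gt_eqF//.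
by rewrite ler_norml; move: fl fg; rewrite intrD => fl fg; apply/andP; split; lra.
Qed.

Lemma cvg_grid (v : 'rV[R]_n) : grid m (rounding m v) @[m --> \oo] --> v.
Proof.
apply/cvgrPdist_le => e e0; near=> m.
rewrite [leLHS]/Num.norm/= mx_normrE; apply/bigmax_leP; split; first exact: ltW.
move=> [i j] _ /=; rewrite ord1.
apply: (le_trans (grid_rounding _ _ _)); apply: ltW.
by near: m; exact: near_infty_natSinv_lt (PosNum e0).
Unshelve. all: by end_near.
Qed.

(** Rounding [X] to a finer and finer grid turns [F (S w) (X w)] into a countable
    case distinction, which is measurable, and converges by continuity. *)
Lemma measurable_caratheodory dO dT (Omega : measurableType dO)
    (T : measurableType dT) (F : T -> 'rV[R]_n -> R) (S : Omega -> T)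
    (X : Omega -> 'rV[R]_n) :
  (forall x, measurable_fun setT (F ^~ x)) -> (forall s, continuous (F s)) ->
  measurable_fun setT S -> measurable_rV X ->
  measurable_fun setT (fun w => F (S w) (X w)).
Proof.
move=> mF cF mS mX.
apply: (@measurable_fun_cvg _ _ _ _ (fun m w => F (S w) (grid m (rounding m (X w))))).
- move=> m _ B mB; rewrite setTI.
  rewrite (_ : _ @^-1` _ = \bigcup_(z : 'rV[int]_n)
    (S @^-1` (F ^~ (grid m z) @^-1` B) `&` [set w | rounding m (X w) = z])).
    apply: countable_bigcupT_measurable => [|z]; first exact: countableP.
    apply: measurableI.
      rewrite -[X in measurable X]setTI; apply: mS => //.
      by rewrite -[X in measurable X]setTI; exact: mF.
    rewrite (_ : [set w | _] = \bigcap_(j in [set: 'I_n])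
        [set w | Num.floor (m.+1%:R * X w 0 j) = z 0 j]).
      apply: fin_bigcap_measurable => // j _.
      rewrite (_ : [set w | _] = (fun w => m.+1%:R * X w 0 j) @^-1`
          `[(z 0 j)%:~R, (z 0 j + 1)%:~R[%classic).
        rewrite -[X in measurable X]setTI.
        by apply: (measurable_funM (measurable_cst _) (mX j)) => //.
      apply/seteqP; split=> w /=; rewrite in_itv/=.
        by move=> <-; rewrite floor_le lt_succ_floor.
      by move=> /floor_def.
    apply/seteqP; split=> w /=; first by move=> <- j _; rewrite mxE.
    by move=> H; apply/rowP => j; rewrite mxE H.
  apply/seteqP; split=> w /=; first by move=> Bw; exists (rounding m (X w)).
  by move=> [z _ [Bz ->]].
- move=> w _; apply: (@cvg_comp _ _ _ (fun m => grid m (rounding m (X w))) (F (S w))).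
    exact: cvg_grid.
  exact: cF.
Qed.

Lemma measurable_continuous dO (Omega : measurableType dO) (k : 'rV[R]_n -> R)
    (X : Omega -> 'rV[R]_n) : continuous k -> measurable_rV X ->
  measurable_fun setT (k \o X).
Proof.
by move=> ck mX; apply: (@measurable_caratheodory _ _ _ _ (fun=> k) id).
Qed.

End Caratheodory.

(** * Independence and Fubini *)

Section Transfer.
Context dO d (Omega : measurableType dO) (T : measurableType d) (R : realType).
Variable Pr : probability Omega R.

Lemma L1_distribution (X : {mfun Omega >-> T}) (f : T -> R) :
  L1 (distribution Pr X) f ->
  L1 Pr (f \o X) /\ mean Pr (f \o X) = mean (distribution Pr X) f.
Proof.
move=> /integrableP[mf foo].
have i1 : L1 Pr (f \o X).
  apply/integrableP; split; first exact: (measurableT_comp mf).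
  by move: foo; rewrite ge0_integral_pushforward//; exact: measurableT_comp.
by split => //; rewrite /mean unlock integral_pushforward.
Qed.

End Transfer.

Section Independence.
Context dO d (Omega : measurableType dO) (T : measurableType d) (R : realType).
Variables (Pr : probability Omega R) (P : probability T R) (n : nat).
Variables (GG : set (set Omega)) (S : Omega -> T) (X : Omega -> 'rV[R]_n).
Hypothesis GG_meas : <<s GG >> `<=` measurable.
Hypothesis S_meas : measurable_fun setT S.
Hypothesis S_law : forall A, measurable A -> Pr (S @^-1` A) = P A.
Hypothesis S_indep :
  indep_systems Pr (preimage_set_system setT S measurable) <<s GG >>.
Hypothesis X_events : rV_events X `<=` <<s GG >>.

(** The probability space with the coarser sigma-algebra generated by [GG],
    viewed as a space of its own: the pair made of the coarsened outcome and the
    sample then has a product law. *)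
Let Omega' : measurableType _ := g_sigma_algebraType GG.

Let coarsen : Omega -> Omega' := id.

Let measurable_coarsen : measurable_fun setT coarsen.
Proof. by move=> _ A mA; rewrite setTI; exact: GG_meas. Qed.

HB.instance Definition _ := isMeasurableFun.Build _ _ _ _ coarsen measurable_coarsen.

Let pair_sample (w : Omega) : (Omega' * T)%type := (coarsen w, S w).

Let measurable_pair : measurable_fun setT pair_sample.
Proof. exact: measurable_fun_pair. Qed.

HB.instance Definition _ := isMeasurableFun.Build _ _ _ _ pair_sample measurable_pair.

Let Pr' : probability Omega' R := distribution Pr coarsen.
Let law : probability (Omega' * T)%type R := distribution Pr pair_sample.

Let product_law A : measurable A -> (Pr' \x P)%E A = law A.
Proof.
apply: product_measure_unique => B C mB mC.
rewrite [LHS](_ : _ = Pr (S @^-1` C `&` B)); last by rewrite setIC.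
rewrite S_indep//; last by exists C; rewrite ?setTI.
by rewrite S_law// muleC.
Qed.

Let X_meas : @measurable_rV _ Omega' R n X.
Proof.
move=> j _ B mB; apply: X_events; exists j => //.
by exists B.
Qed.

(** Under the product law of [pair_sample], Fubini's theorem integrates over the
    sample first, while the coarsened outcome, and with it [X], is frozen. The
    bound by a product makes the integrand integrable for the product law. *)
Lemma mean_freeze (Z : T -> 'rV[R]_n -> R) (a : T -> R) (b : 'rV[R]_n -> R) :
  (forall x, measurable_fun setT (Z ^~ x)) -> (forall s, continuous (Z s)) ->
  continuous b -> L1 P a -> L1 Pr (b \o X) ->
  (forall s w, `|Z s (X w)| <= a s * b (X w)) ->
  [/\ L1 Pr (fun w => Z (S w) (X w)),
      L1 Pr (fun w => mean P (Z ^~ (X w))) &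
      mean Pr (fun w => Z (S w) (X w)) =
      mean Pr (fun w => mean P (Z ^~ (X w)))].
Proof.
move=> mZ cZ cb ia ib Zab.
pose H (p : Omega' * T) := Z p.2 (X p.1).
have mH : measurable_fun setT H.
  apply: (@measurable_caratheodory R n _ _ (Omega' * T)%type T Z snd
    (fun p => X p.1)) => // j.
  exact: (@measurableT_comp _ _ _ _ _ _ (fun w : Omega' => X w 0 j) _ fst).
have iZ w : L1 P (Z ^~ (X w)).
  apply: (@L1_le _ _ _ _ _ (fun s => b (X w) * a s)) => //; last exact: L1Z.
  by move=> s; rewrite mulrC.
have mb' : measurable_fun [set: Omega'] (b \o X) by exact: measurable_continuous.
have ib' : L1 Pr' (b \o X).
  have /integrableP[_ boo] := ib.
  apply/integrableP; split; first exact/measurable_EFinP.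
  move: boo; rewrite [X in _ -> (X < _)%E]ge0_integral_pushforward//.
  by apply: measurableT_comp => //; exact/measurable_EFinP.
have iH : (Pr' \x P)%E.-integrable setT (EFin \o H).
  apply/integrable12ltyP; first exact/measurable_EFinP.
  have iab : L1 Pr' (fun w => mean P a * b (X w)) by exact: L1Z.
  have iabE := integrable_fin_num measurableT iab.
  apply: (@le_lt_trans _ _ (\int[Pr']_w (mean P a * b (X w))%:E)%E); last first.
    by rewrite ltey_eq iabE.
  have inner w : (\int[P]_s `|(EFin \o H) (w, s)| <= (mean P a * b (X w))%:E)%E.
    have iaZ : L1 P (fun s => `|Z s (X w)|).
      by have := integrable_abse (iZ w).
    rewrite (_ : (\int[P]_s _)%E = (mean P (fun s => `|Z s (X w)|))%:E); last first.
      by rewrite -mean_EFin// unlock.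
    rewrite lee_fin mulrC -meanZ//; apply: mean_le => //; first exact: L1Z.
    by move=> s; rewrite mulrC.
  apply: ge0_le_integral => //.
  - by move=> w _; exact: integral_ge0.
  - apply: (measurable_fun_fubini_tonelli_F (abse \o (EFin \o H))) => //.
      by apply: measurableT_comp => //; exact/measurable_EFinP.
    by move=> p; exact: abse_ge0.
  - by case/integrableP : iab.
have iH' : L1 law H.
  have /integrableP[mH' Hoo] := iH.
  apply/integrableP; split => //; apply: le_lt_trans Hoo.
  rewrite le_eqVlt; apply/orP; left; apply/eqP.
  by apply: eq_measure_integral => A mA _; exact/esym/product_law.
have [i1 e1] := L1_distribution iH'.
have iF := integrable_fubini_F iH.
have FE : fubini_F P (EFin \o H) = (fun w => (mean P (Z ^~ (X w)))%:E).
  apply/funext => w; rewrite /fubini_F -mean_EFin// unlock.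
  by [].
rewrite FE in iF.
have [i2 e2] := L1_distribution (iF : L1 Pr' _).
split => //.
transitivity (mean law H) => //.
rewrite [RHS]e2.
have := integral12_prod_meas1 iH; rewrite FE => e3.
rewrite meanE [RHS]meanE /Rintegral e3; congr fine.
by apply: eq_measure_integral => A mA _; exact/esym/product_law.
Qed.

End Independence.

(** * One step of the method *)

Section Step.
Variables (R : realType) (n : nat).
Implicit Types (x y z g : 'rV[R]_n).
Variables (phi : 'rV[R]_n -> \bar R).
Hypothesis phi_proper : eproper phi.

Let D := edom phi.
Let phir := fine \o phi.

Hypothesis phi_convex : convex_on D phir.

Lemma model_argmin_dom (fs : 'rV[R]_n -> R) (c alpha : R) x g xp z :
  argmin (prox_sps_model fs phi c alpha x g) xp -> D z -> D xp.
Proof.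
move=> amin Dz; rewrite /D /edom /= ltNge leye_eq; apply/negP => /eqP xpoo.
have := amin z; rewrite /prox_sps_model xpoo -(edom_fineK phi_proper Dz).
by rewrite addey// addye// leye_eq.
Qed.

(** [prox_growth] applied to the truncated model. The model is at most
    [fs + rs / 2 * |. - x|^2] because [g] is a subgradient up to that quadratic
    term and [c <= fs]; it is at least the linearisation of [fs] at [x]. *)
Lemma model_step (fs : 'rV[R]_n -> R) (rs Gs c alpha : R) x g xp z :
  0 <= rs -> continuous fs -> weakly_convex rs fs -> clarke_subdiff fs x g ->
  (forall y, c <= fs y) -> enorm g <= Gs -> 0 < alpha ->
  argmin (prox_sps_model fs phi c alpha x g) xp -> D z ->
  D xp /\
  fs x - Gs * enorm (xp - x) + phir xp + 1 / (2 * alpha) * enorm (xp - x) ^+ 2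
    + 1 / (2 * alpha) * enorm (z - xp) ^+ 2 <=
  fs z + rs / 2 * enorm (z - x) ^+ 2 + phir z
    + 1 / (2 * alpha) * enorm (z - x) ^+ 2.
Proof.
move=> rs0 cfs wfs gx cle gG a0 amin Dz.
set beta := 1 / (2 * alpha).
have b0 : 0 <= beta by rewrite divr_ge0// mulr_ge0// ltW.
pose m y := Num.max (fs x + dot g (y - x)) c.
pose q y := m y + phir y.
have modelE y : D y -> prox_sps_model fs phi c alpha x g y =
    (q y + beta * enorm (y - x) ^+ 2)%:E.
  by move=> Dy; rewrite /prox_sps_model -(edom_fineK phi_proper Dy).
have Dxp := model_argmin_dom amin Dz; split => //.
have qmin y : D y ->
    q xp + beta * enorm (xp - x) ^+ 2 <= q y + beta * enorm (y - x) ^+ 2.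
  by move=> Dy; have := amin y; rewrite !modelE.
have cq : convex_on D q.
  move=> y w t Dy Dw t0 t1; have [Dv Hp] := phi_convex Dy Dw t0 t1; split=> //.
  suff : m (t *: y + (1 - t) *: w) <= t * m y + (1 - t) * m w.
    by move: Hp; rewrite /q; lra.
  have m1 v : fs x + dot g (v - x) <= m v by rewrite le_max lexx.
  have m2 v : c <= m v by rewrite le_max lexx orbT.
  have t1' : 0 <= 1 - t by lra.
  rewrite ge_max; apply/andP; split.
    have -> : t *: y + (1 - t) *: w - x = t *: (y - x) + (1 - t) *: (w - x).
      by apply/rowP => j; rewrite !mxE; ring.
    rewrite dotDr !dotZr.
    have := ler_wpM2l t0 (m1 y); have := ler_wpM2l t1' (m1 w); lra.
  have := ler_wpM2l t0 (m2 y); have := ler_wpM2l t1' (m2 w); lra.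
have := prox_growth cq b0 Dxp Dz qmin.
have mxp : fs x - Gs * enorm (xp - x) <= m xp.
  rewrite le_max; apply/orP; left.
  have := normr_dot g (xp - x); rewrite ler_norml => /andP[+ _].
  have := ler_wpM2r (enorm_ge0 (xp - x)) gG; lra.
have mz : m z <= fs z + rs / 2 * enorm (z - x) ^+ 2.
  rewrite ge_max; apply/andP; split.
    by have := clarke_subgradient z rs0 cfs wfs gx; lra.
  have := cle z; have : 0 <= rs / 2 * enorm (z - x) ^+ 2.
    by rewrite mulr_ge0 ?sqr_ge0// divr_ge0.
  lra.
rewrite /q; lra.
Qed.

Variables (F : 'rV[R]_n -> R) (U : set 'rV[R]_n) (rho L : R).
Hypothesis rho_gt0 : 0 < rho.
Hypothesis dom_U : D `<=` U.
Hypothesis F_lip : forall x y, U x -> U y -> F x <= F y + L * enorm (y - x).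
Hypothesis F_wconvex : weakly_convex rho F.

Variable prox : 'rV[R]_n -> 'rV[R]_n.
Hypothesis proxP : forall x, is_prox D (composite phi F) rho x (prox x).

(** The part of the one-step inequality that depends on the sample and on the
    current point only; its expectation over the sample is
    [sample_term F rho x]. *)
Definition sample_term (fs : 'rV[R]_n -> R) (rs : R) x :=
  rs / 2 * enorm (x - prox x) ^+ 2 - (fs x - fs (prox x)).

(** Compare the three-point inequality at [prox x] with [menv_growth] at the new
    point [xp]. The remaining error is
    [(Gs + L) t - r / 2 * t^2], where [t = |xp - x|]. As [r] may vanish, a small
    part of the decrease, via [t^2 <= 2 |xp - prox x|^2 + 2 |x - prox x|^2],
    supplies the quadratic term that bounds it; the share [rho / 12] is small
    enough for the constants of the final rate. *)
Lemma step_decrease (fs : 'rV[R]_n -> R) (rs Gs c r : R) x g xp :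
  0 <= r -> 0 <= rs -> continuous fs -> weakly_convex rs fs ->
  clarke_subdiff fs x g -> (forall y, c <= fs y) -> enorm g <= Gs -> U x ->
  argmin (prox_sps_model fs phi c (2 * rho + r)^-1 x g) xp ->
  D xp /\
  (rho + r / 2 + rho / 3) *
    (menv (composite phi F) rho prox xp - menv (composite phi F) rho prox x) <=
  rho * (sample_term fs rs x - sample_term F rho x
         - (2 * rho / 3) * enorm (x - prox x) ^+ 2
         + (Gs + L) ^+ 2 / (4 * (r / 2 + rho / 12))).
Proof.
move=> r0 rs0 cfs wfs gx cle gG Ux amin; have rho0 := rho_gt0.
have al0 : 0 < (2 * rho + r)^-1 by rewrite invr_gt0; lra.
have betaE : 1 / (2 * (2 * rho + r)^-1) = rho + r / 2.
  by field; rewrite gt_eqF//; lra.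
have Dh := (proxP x).1.
have [Dxp] := model_step rs0 cfs wfs gx cle gG al0 amin Dh; rewrite betaE => H1.
split => //.
have cw := composite_wconvex F_wconvex phi_convex.
have H2 := F_lip (dom_U Dxp) Ux.
have H3 := menv_growth rho_gt0 cw proxP x Dxp.
have H4 := menv_le proxP xp Dh.
rewrite /sample_term.
have compE y : composite phi F y = F y + phir y by [].
set V := menv _ _ _ xp in H4 *; set V0 := menv _ _ _ x in H3 *.
have V0E : V0 = F (prox x) + phir (prox x) + rho * enorm (x - prox x) ^+ 2.
  by rewrite /V0 /menv (enormC x).
move: H1 H2 H3 H4; rewrite !compE.
rewrite (enormC x xp) (enormC (prox x) xp) (enormC (prox x) x).
have H5 : enorm (xp - x) ^+ 2 <=
    2 * enorm (xp - prox x) ^+ 2 + 2 * enorm (x - prox x) ^+ 2.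
  rewrite !enorm_sqr /dot !mulr_sumr -big_split/=; apply: ler_sum => j _.
  by rewrite !mxE; have := sqr_ge0 (xp 0 j + x 0 j - 2 * prox x 0 j); lra.
set k := r / 2 + rho / 12.
have k0 : 0 < k by rewrite /k; lra.
rewrite -/k; set t := enorm (xp - x) in H5 *.
set a := enorm (xp - prox x) ^+ 2 in H5 *.
set d := enorm (x - prox x) ^+ 2 in V0E H5 *.
have H6 : (Gs + L) * t <= (Gs + L) ^+ 2 / (4 * k) + k * t ^+ 2.
  rewrite -(ler_pM2l k0) [leRHS]mulrDr.
  rewrite (_ : k * (_ / _) = (Gs + L) ^+ 2 / 4); last by field; rewrite gt_eqF.
  by have := sqr_ge0 ((Gs + L) / 2 - k * t); lra.
set Q := _ / (4 * k) in H6 *.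
move=> H1 H2 H3 H4.
have key : (rho + r / 2 + rho / 3) * a <= (rho + r / 2 - rho / 3) * d
   + (rs / 2 * d - (fs x - fs (prox x)) - (rho / 2 * d - (F x - F (prox x)))) + Q.
  by have := ler_wpM2l (ltW rho0) H5; rewrite /k in H6; lra.
have : (rho + r / 2 + rho / 3) * (V - V0) <=
    (rho + r / 2 + rho / 3) * (rho * (a - d)).
  by rewrite ler_pM2l; lra.
by have := ler_wpM2l (ltW rho_gt0) key; lra.
Qed.

End Step.

(** * Expected decrease of the envelope *)

Section ExpectedDecrease.
Context (R : realType) (n : nat) (dO dS : measure_display).
Context (Omega : measurableType dO) (T : measurableType dS).
Variables (Pr : probability Omega R) (P : probability T R).
Variables (f : T -> 'rV[R]_n -> R) (phi : 'rV[R]_n -> \bar R) (C : T -> R).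
Hypothesis f_cont : forall s, continuous (f s).
Hypothesis f_int : forall x, L1 P (f ^~ x).
Hypothesis C_le : forall s y, C s <= f s y.
Hypothesis phi_proper : eproper phi.
Hypothesis phi_convex : convex_on (edom phi) (fine \o phi).
Variable U : set 'rV[R]_n.
Hypotheses (U_open : open U) (U_convex : convex_set U).
Hypothesis dom_U : edom phi `<=` U.
Variable rhos : T -> R.
Hypothesis rhos_gt0 : forall s, 0 < rhos s.
Hypothesis f_wconvex : forall s, weakly_convex (rhos s) (f s).
Hypothesis rhos_int : L1 P rhos.
Variable Gs : T -> R.
Hypothesis Gs_ge0 : forall s, 0 <= Gs s.
Hypothesis Gs_meas : measurable_fun setT Gs.
Hypothesis Gs_int : L1 P (fun s => Gs s ^+ 2).
Hypothesis Gs_bound :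
  forall s x g, U x -> clarke_subdiff (f s) x g -> enorm g <= Gs s.

Let F := mean_fun P f.
Let rho := mean P rhos.
Let L := mean P Gs.
Let q := composite phi F.

Lemma sample_lipschitz s x y : U x -> U y ->
  f s x <= f s y + Gs s * enorm (y - x).
Proof.
move=> Ux Uy; apply: (@clarke_lipschitz _ _ (rhos s) (C s) _ _ U) => //.
- exact: ltW.
- by move=> z g; exact: Gs_bound.
Qed.

Lemma objective_lipschitz x y : U x -> U y -> F x <= F y + L * enorm (y - x).
Proof.
move=> Ux Uy; apply: mean_fun_lipschitz => //; first exact: L1_square.
by move=> s; exact: sample_lipschitz.
Qed.

Lemma objective_wconvex : weakly_convex rho F.
Proof. exact: mean_fun_wconvex. Qed.

Lemma mean_rhos_gt0 : 0 < rho.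
Proof. exact: mean_gt0. Qed.

Variable prox : 'rV[R]_n -> 'rV[R]_n.
Hypothesis proxP : forall x, is_prox (edom phi) q rho x (prox x).
Variable m : R.
Hypothesis q_ge : forall y, edom phi y -> m <= q y.

Definition gap x := menv q rho prox x - m.

Lemma prox_dist_le_gap x : rho * prox_dist prox x <= gap x.
Proof.
rewrite /gap /menv /prox_dist (enormC x); have := q_ge (proxP x).1; lra.
Qed.

Lemma gap_ge0 x : 0 <= gap x.
Proof.
apply: le_trans (prox_dist_le_gap x).
by rewrite mulr_ge0 ?sqr_ge0// ltW// mean_rhos_gt0.
Qed.

Let q_wconvex := composite_wconvex objective_wconvex phi_convex.

Lemma continuous_gap : continuous gap.
Proof.
move=> x; apply: (@cvgB _ _ _ (nbhs x)); last exact: cvg_cst.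
exact: (continuous_menv mean_rhos_gt0 q_wconvex proxP).
Qed.

Let continuous_dist := continuous_prox_dist mean_rhos_gt0 q_wconvex proxP.

Section OneStep.
Variables (S : Omega -> T) (x g xp : Omega -> 'rV[R]_n) (GG : set (set Omega)).
Variable r : R.
Hypothesis r_ge0 : 0 <= r.
Hypothesis GG_meas : <<s GG >> `<=` measurable.
Hypothesis S_meas : measurable_fun setT S.
Hypothesis S_law : forall A, measurable A -> Pr (S @^-1` A) = P A.
Hypothesis S_indep :
  indep_systems Pr (preimage_set_system setT S measurable) <<s GG >>.
Hypothesis x_events : rV_events x `<=` <<s GG >>.
Hypotheses (x_meas : measurable_rV x) (xp_meas : measurable_rV xp).
Hypothesis x_U : forall w, U (x w).
Hypothesis g_clarke : forall w, clarke_subdiff (f (S w)) (x w) (g w).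
Hypothesis xp_min : forall w,
  argmin (prox_sps_model (f (S w)) phi (C (S w)) (2 * rho + r)^-1 (x w) (g w))
    (xp w).
Hypothesis gap_int : L1 Pr (gap \o x).

Lemma prox_dist_int : L1 Pr (prox_dist prox \o x).
Proof.
apply: (@L1_le _ _ _ _ _ (fun w => rho^-1 * gap (x w))); last exact: L1Z.
  exact: measurable_continuous continuous_dist x_meas.
move=> w; rewrite ger0_norm ?sqr_ge0// mulrC ler_pdivlMr ?mean_rhos_gt0// mulrC.
exact: prox_dist_le_gap.
Qed.

Let kappa := r / 2 + rho / 12.

Let kappa_gt0 : 0 < kappa.
Proof. by have := mean_rhos_gt0; rewrite /kappa => h; have := r_ge0; lra. Qed.

Let Z s y := sample_term prox (f s) (rhos s) y + (Gs s + L) ^+ 2 / (4 * kappa).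

Let err_int : L1 P (fun s => (Gs s + L) ^+ 2 / (4 * kappa)).
Proof.
have iG := L1_square Gs_meas Gs_int.
rewrite (_ : (fun s => _) = (fun s => (4 * kappa)^-1 *
    (Gs s ^+ 2 + (2 * L) * Gs s + L ^+ 2))).
  by apply: L1Z; apply: L1D; [apply: L1D => //; exact: L1Z|exact: L1_cst].
by apply/funext => s; rewrite mulrC; congr (_ * _); ring.
Qed.

Let err_le : mean P (fun s => (Gs s + L) ^+ 2 / (4 * kappa)) <=
  mean P (fun s => Gs s ^+ 2) / kappa.
Proof.
have L2 := mean_square Gs_meas Gs_int; rewrite -/L in L2.
have k4 : 0 < 4 * kappa by rewrite mulr_gt0.
set G2 := mean P _ in L2 *.
apply: (@le_trans _ _ (mean P (fun s => (2 * kappa)^-1 * (Gs s ^+ 2 + L ^+ 2)))).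
  have iX : L1 P (fun s => Gs s ^+ 2 + L ^+ 2).
    by apply: L1D => //; exact: L1_cst.
  apply: mean_le => //; first exact: L1Z.
  move=> s; rewrite ler_pdivrMr//.
  rewrite (_ : _ * (4 * kappa) = 2 * (Gs s ^+ 2 + L ^+ 2)); last first.
    by field; rewrite gt_eqF.
  by have := sqr_ge0 (Gs s - L); lra.
have iL : L1 P (fun=> L ^+ 2) by exact: L1_cst.
rewrite meanZ ?meanD ?mean_cst//; last by apply: L1D.
rewrite -/G2 ler_pdivlMr// [leLHS](_ : _ = (G2 + L ^+ 2) / 2); first lra.
by field; rewrite gt_eqF.
Qed.

Let sample_term_int y : L1 P (fun s => sample_term prox (f s) (rhos s) y).
Proof.
apply: L1B; last exact: L1B.
rewrite (_ : (fun s => _) = fun s => (enorm (y - prox y) ^+ 2 / 2) * rhos s).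
  exact: L1Z.
by apply/funext => s; ring.
Qed.

Let mean_Z y : mean P (Z ^~ y) =
  sample_term prox F rho y + mean P (fun s => (Gs s + L) ^+ 2 / (4 * kappa)).
Proof.
rewrite /Z meanD//; congr (_ + _).
have i1 : L1 P (fun s => rhos s / 2 * enorm (y - prox y) ^+ 2).
  rewrite (_ : (fun s => _) = fun s => (enorm (y - prox y) ^+ 2 / 2) * rhos s).
    exact: L1Z.
  by apply/funext => s; ring.
have i2 : L1 P (fun s => f s y - f s (prox y)) by exact: L1B.
rewrite /sample_term meanB// meanB//; congr (_ - _).
rewrite (_ : (fun s => _) = fun s => (enorm (y - prox y) ^+ 2 / 2) * rhos s).
  by rewrite meanZ// -/rho; ring.
by apply/funext => s; ring.
Qed.

Let continuous_Z s : continuous (Z s).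
Proof.
move=> y; apply: (@cvgD _ _ _ (nbhs y)); last exact: cvg_cst.
have cp := continuous_prox mean_rhos_gt0 q_wconvex proxP.
apply: (@cvgB _ _ _ (nbhs y)).
  by apply: (@cvgMl_tmp _ _ (nbhs y)); exact: continuous_dist.
apply: (@cvgB _ _ _ (nbhs y)); first exact: f_cont.
apply: (@continuous_comp _ _ _ prox (f s)); first exact: cp.
exact: f_cont.
Qed.

Let Z_bound s w : `|Z s (x w)| <=
  (rhos s + Gs s + (Gs s + L) ^+ 2 / (4 * kappa)) * (1 + prox_dist prox (x w)).
Proof.
set e := _ / (4 * kappa).
have e0 : 0 <= e by rewrite divr_ge0 ?sqr_ge0// mulr_ge0// ltW.
have Uh : U (prox (x w)) by exact: dom_U (proxP (x w)).1.
have := sample_lipschitz s (x_U w) Uh; have := sample_lipschitz s Uh (x_U w).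
rewrite (enormC (prox (x w))) /Z /sample_term /prox_dist -/e.
set u := enorm _; set df := f s (x w); set dp := f s _ => H1 H2.
have u0 : 0 <= u by exact: enorm_ge0.
have u1 : Gs s * u <= Gs s * (1 + u ^+ 2).
  by rewrite ler_wpM2l//; have := sqr_ge0 (u - 1); lra.
have r0 := ltW (rhos_gt0 s).
have : 0 <= rhos s * u ^+ 2 by rewrite mulr_ge0// sqr_ge0.
have : 0 <= e * u ^+ 2 by rewrite mulr_ge0// sqr_ge0.
by move=> H3 H4; rewrite ler_norml; apply/andP; split; lra.
Qed.

(** The sample enters the one-step inequality only through [Z], whose
    expectation, given the past, is obtained by freezing the current point. *)
Lemma expected_decrease :
  L1 Pr (gap \o xp) /\
  2 * rho ^+ 2 / 3 * mean Pr (prox_dist prox \o x) <=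
    (rho + r / 2 + rho / 3) * (mean Pr (gap \o x) - mean Pr (gap \o xp))
    + rho * (mean P (fun s => Gs s ^+ 2) / kappa).
Proof.
have r0 := mean_rhos_gt0; have iG := L1_square Gs_meas Gs_int.
set B := rho + r / 2 + rho / 3.
have B0 : 0 < B by rewrite /B; have := r_ge0; lra.
set c := mean P (fun s => (Gs s + L) ^+ 2 / (4 * kappa)).
have [||||i1 i2 e12] := @mean_freeze _ _ _ _ _ Pr P n GG S x GG_meas S_meas S_law
  S_indep x_events Z (fun s => rhos s + Gs s + (Gs s + L) ^+ 2 / (4 * kappa))
  (fun y => 1 + prox_dist prox y) _ continuous_Z _ _ _ Z_bound.
- by move=> y; apply: (@L1_measurable _ _ _ P); exact: L1D.
- move=> y; apply: (@cvgD _ _ _ (nbhs y)); first exact: cvg_cst.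
  exact: continuous_dist.
- by apply: L1D => //; exact: L1D.
- by apply: L1D; [exact: L1_cst|exact: prox_dist_int].
pose W w := mean P (Z ^~ (x w)).
pose rhs w := gap (x w) + (rho / B) *
  ((Z (S w) (x w) - (W w - c)) - (2 * rho / 3) * prox_dist prox (x w)).
have le_rhs w : gap (xp w) <= rhs w.
  have gG := Gs_bound (x_U w) (g_clarke w).
  have [_] := step_decrease phi_proper phi_convex mean_rhos_gt0 dom_U
    objective_lipschitz objective_wconvex proxP r_ge0 (ltW (rhos_gt0 (S w)))
    (@f_cont (S w)) (@f_wconvex (S w)) (g_clarke w) (C_le (S w)) gG (x_U w)
    (xp_min w).
  rewrite -/B -/kappa -/q => H.
  rewrite /rhs /gap /W mean_Z addrK -(ler_pM2l B0).
  rewrite [leRHS]mulrDr [X in _ <= _ + X]mulrA (mulrC B (rho / B)) divfK ?gt_eqF//.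
  rewrite /Z /prox_dist; lra.
have iD := prox_dist_int.
have iN : L1 Pr (fun w => Z (S w) (x w) - (W w - c)).
  by apply: L1B => //; apply: L1B => //; exact: L1_cst.
have iE : L1 Pr (fun w => (Z (S w) (x w) - (W w - c))
    - (2 * rho / 3) * prox_dist prox (x w)).
  by apply: L1B => //; exact: L1Z.
have irhs : L1 Pr rhs by apply: L1D => //; exact: L1Z.
have ixp : L1 Pr (gap \o xp).
  apply: (L1_le _ _ irhs); first exact: measurable_continuous continuous_gap _.
  by move=> w; rewrite /= ger0_norm ?gap_ge0//; exact: le_rhs.
split => //.
have := mean_le ixp irhs le_rhs; rewrite /rhs.
have ic : L1 Pr (fun=> c) by exact: L1_cst.
have iW : L1 Pr (fun w => W w - c) by exact: L1B.
have iD2 : L1 Pr (fun w => (2 * rho / 3) * prox_dist prox (x w)) by exact: L1Z.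
rewrite meanD ?meanZ//; last exact: L1Z.
rewrite (meanB iN iD2) (meanB i1 iW) (meanB i2 ic) mean_cst (meanZ _ iD) e12.
rewrite -(ler_pM2l B0) [leRHS]mulrDr [X in _ <= _ + X]mulrA (mulrC B (rho / B)).
rewrite divfK ?gt_eqF//.
have := ler_wpM2l (ltW r0) err_le; rewrite -/c.
rewrite -!/(gap \o _) -!/(prox_dist prox \o _); lra.
Qed.

End OneStep.
End ExpectedDecrease.

(** * A random index *)

Section RandomIndex.
Context (R : realType) (n : nat) (dO : measure_display).
Context (Omega : measurableType dO) (Pr : probability Omega R) (K : nat).
Variables (x : nat -> Omega -> 'rV[R]_n) (J : Omega -> 'I_K).
Hypothesis J_unif : uniform_index Pr x J.
Hypothesis x_meas : forall k, (k < K)%N -> measurable_rV (x k).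

Lemma rV_events_measurable (X : Omega -> 'rV[R]_n) : measurable_rV X ->
  rV_events X `<=` measurable.
Proof. by move=> mX A [j _ [B mB <-]]; exact: mX. Qed.

(** Each indicator of [J = j] is a boolean sample independent of the iterates, to
    which [mean_freeze] applies. *)
Lemma mean_uniform_index (h : 'rV[R]_n -> R) : continuous h ->
  (forall y, 0 <= h y) -> (forall k, (k < K)%N -> L1 Pr (h \o x k)) ->
  L1 Pr (fun w => h (x (J w) w)) /\
  mean Pr (fun w => h (x (J w) w)) = K%:R^-1 * \sum_(j < K) mean Pr (h \o x j).
Proof.
move=> ch h0 ih; set GG := \bigcup_(k in `I_K) rV_events (x k).
have GGm : <<s GG >> `<=` measurable.
  apply: smallest_sub; first exact: sigma_algebra_measurable.
  by move=> A [k /= kK]; apply: rV_events_measurable; exact: x_meas.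
have one j : L1 Pr (fun w => (J w == j)%:R * h (x j w)) /\
    mean Pr (fun w => (J w == j)%:R * h (x j w)) = K%:R^-1 * mean Pr (h \o x j).
  pose S w := J w == j.
  have mS : measurable_fun setT S.
    apply: (measurable_fun_bool true); rewrite setTI.
    rewrite (_ : _ @^-1` _ = J @^-1` [set j]); first exact: uidx_meas J_unif _.
    by apply/seteqP; split=> w /= /eqP.
  pose SM : {mfun Omega >-> bool} := HB.pack S (isMeasurableFun.Build _ _ _ _ S mS).
  have S_indep : indep_systems Pr (preimage_set_system setT S measurable) <<s GG >>.
    move=> A B [A' mA' <-] GB; apply: (uidx_indep J_unif) => //.
    by exists [set i | A' (i == j)].
  have iB : L1 (distribution Pr SM) (fun b : bool => b%:R).
    apply: (@L1_le _ _ _ _ _ (fun=> 1)) => //; last exact: L1_cst.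
    by move=> [] /=; rewrite ?normr1 ?normr0.
  have mB : mean (distribution Pr SM) (fun b : bool => b%:R) = K%:R^-1.
    have [_ <-] := L1_distribution iB.
    rewrite /mean (_ : _ \o _ = \1_(J @^-1` [set j])).
      by rewrite expectation_indic ?(uidx_law J_unif)//; exact: uidx_meas J_unif _.
    apply/funext => w /=; rewrite indicE /S.
    suff -> : (w \in J @^-1` [set j]) = (J w == j) by [].
    by apply/idP/idP; rewrite inE => /eqP.
  have [||||||i1 _ ->] := @mean_freeze _ _ _ _ _ Pr (distribution Pr SM) n GG S
    (x j) GGm mS _ S_indep _ (fun b y => b%:R * h y) (fun=> 1) h _ _ ch _
    (ih j (ltn_ord j)) _.
  - by [].
  - by move=> A [i _ iA]; apply: sub_sigma_algebra; exists j => //=; exists i.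
  - by move=> y.
  - by move=> b y; apply: (@cvgMl_tmp _ _ (nbhs y)); exact: ch.
  - exact: L1_cst.
  - by move=> [] w; rewrite ?mul1r ?mul0r ?normr0// ger0_norm.
  split => //; rewrite -meanZ//; last exact: ih.
  congr mean; apply/funext => w; rewrite mulrC -mB -meanZ//.
  by congr mean; apply/funext => b; rewrite mulrC.
have E w : h (x (J w) w) = \sum_(j < K) (J w == j)%:R * h (x j w).
  rewrite (bigD1 (J w))//= eqxx mul1r big1 ?addr0// => j.
  by rewrite eq_sym => /negbTE ->; rewrite mul0r.
rewrite (_ : (fun w => _) = fun w => \sum_(j < K) (J w == j)%:R * h (x j w)).
  split; first by apply: L1_sum => j; exact: (one j).1.
  rewrite mean_sum ?mulr_sumr; last by move=> j; exact: (one j).1.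
  by apply: eq_bigr => j _; exact: (one j).2.
exact/funext.
Qed.

End RandomIndex.

(** * The rate of convergence *)

(** With [r = sqrt (4 rho G^2 K / Delta)] both error terms are multiples of
    [G q], where [q = sqrt (rho Delta / K)]. *)
Lemma rate_bound (R : realType) (rho G Delta k r D : R) :
  0 < rho -> 0 <= G -> 0 < Delta -> 0 < k ->
  r = Num.sqrt (4 * rho * G ^+ 2 * k / Delta) ->
  2 * rho ^+ 2 / 3 * D <= (rho + r / 2 + rho / 3) * Delta
    + k * (rho * (G ^+ 2 / (r / 2 + rho / 12))) ->
  4 * rho ^+ 2 * (k^-1 * D) <=
    8 * rho * Delta / k + 16 * G * Num.sqrt (rho * Delta / k).
Proof.
move=> rho0 G0 Delta0 k0 rE H.
set q := Num.sqrt _.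
have q0 : 0 <= q by exact: sqrtr_ge0.
have q2 : q ^+ 2 = rho * Delta / k.
  by rewrite sqr_sqrtr// divr_ge0 ?mulr_ge0 ?ltW.
have Gq0 : 0 <= G * q by exact: mulr_ge0.
have r0 : 0 <= r by rewrite rE sqrtr_ge0.
have rq : r * Delta = 2 * (G * q) * k.
  have -> : r = 2 * G * q * k / Delta.
    rewrite rE (_ : _ / Delta = (2 * G * q * k / Delta) ^+ 2).
      by rewrite sqrtr_sqr ger0_norm// !mulr_ge0 ?invr_ge0// ltW.
    have -> : (2 * G * q * k / Delta) ^+ 2 = 4 * G ^+ 2 * q ^+ 2 * k ^+ 2 / Delta ^+ 2.
      by field; rewrite gt_eqF.
    by rewrite q2; field; rewrite !gt_eqF.
  by field; rewrite gt_eqF.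
set kappa := r / 2 + rho / 12 in H.
have kappa0 : 0 < kappa by rewrite /kappa; lra.
have err : rho * (G ^+ 2 / kappa) <= G * q.
  rewrite mulrA ler_pdivrMr//.
  have e1 : G * q * (r / 2) * Delta = rho * G ^+ 2 * Delta.
    transitivity (G * q * (r * Delta) / 2); first by field.
    rewrite rq; transitivity (G ^+ 2 * q ^+ 2 * k); first by field.
    by rewrite q2; field; rewrite gt_eqF.
  have e2 := mulIf (lt0r_neq0 Delta0) e1.
  have : 0 <= G * q * rho by rewrite mulr_ge0// ltW.
  by rewrite /kappa mulrDr e2; lra.
rewrite -(ler_pM2l k0).
have -> : k * (4 * rho ^+ 2 * (k^-1 * D)) = 4 * rho ^+ 2 * D.
  by field; rewrite gt_eqF.
have -> : k * (8 * rho * Delta / k + 16 * G * q) =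
    8 * rho * Delta + 16 * (G * q) * k.
  by field; rewrite gt_eqF.
have := ler_wpM2l (ltW k0) err.
have : 0 <= G * q * k by rewrite mulr_ge0// ltW.
lra.
Qed.

Theorem corollary4
  (R : realType) (n : nat)
  (dO dS : measure_display)
  (Omega : measurableType dO) (T : measurableType dS)
  (Pr : probability Omega R) (P : probability T R)
  (f : T -> 'rV[R]_n -> R) (phi : 'rV[R]_n -> \bar R) (C : T -> R)
  (f_lip : forall s, locally_lipschitz (f s))
  (f_int : forall x, P.-integrable setT (fun s => (f s x)%:E))
  (C_le : forall s, ((C s)%:E <= ereal_inf (range (fun x => (f s x)%:E)))%E)
  (psi : 'rV[R]_n -> \bar R)
  (psiE : psi = fun x => ((mean_fun P f x)%:E + phi x)%E)
  (psi_min : argmin psi !=set0)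
  (lambda : R) (lambda_ge0 : 0 <= lambda)
  (phi_proper : eproper phi) (phi_closed : closed_fun phi)
  (phi_sconvex : strongly_convex lambda phi)
  (U : set 'rV[R]_n) (U_open : open U) (U_convex : convex_set U)
  (dom_U : edom phi `<=` U)
  (rhos : T -> R) (rhos_gt0 : forall s, 0 < rhos s)
  (f_wconvex : forall s, weakly_convex (rhos s) (f s))
  (rhos_int : P.-integrable setT (fun s => (rhos s)%:E))
  (rho : R) (rhoE : rho = fine ('E_P[rhos])%E)
  (Gs : T -> R) (Gs_ge0 : forall s, 0 <= Gs s)
  (Gs_meas : measurable_fun setT Gs)
  (Gs_int : P.-integrable setT (fun s => (Gs s ^+ 2)%:E))
  (Gs_bound : forall s x g, U x -> clarke_subdiff (f s) x g -> enorm g <= Gs s)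
  (G : R) (GE : G = Num.sqrt (fine ('E_P[fun s => (Gs s ^+ 2)%R])%E))
  (x0 : 'rV[R]_n) (x0_U : U x0)
  (Delta : R) (Delta_gt0 : 0 < Delta)
  (Delta_ge : (env (1 / (2 * rho)) psi x0 - emin psi <= Delta%:E)%E)
  (K : nat) (K_ge1 : (1 <= K)%N)
  (S : nat -> Omega -> T) (g x : nat -> Omega -> 'rV[R]_n)
  (run : prox_sps Pr P f phi C x0
    (fun _ => (2 * rho + Num.sqrt (4 * rho * G ^+ 2 * K%:R / Delta))^-1)
    K S g x)
  (J : Omega -> 'I_K) (J_unif : uniform_index Pr x J) :
  ('E_Pr[fun w => (enorm (gradient (fine \o env (1 / (2 * rho)) psi)
                            (x (J w) w)) ^+ 2)%R]
   <= (8 * rho * Delta / K%:R + 16 * G * Num.sqrt (rho * Delta / K%:R))%:E)%E.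
Proof.
have G2E : G ^+ 2 = mean P (fun s => Gs s ^+ 2).
  by rewrite GE sqr_sqrtr//; apply: mean_ge0 => s; exact: sqr_ge0.
have G0 : 0 <= G by rewrite GE sqrtr_ge0.
rewrite -/(mean P rhos) in rhoE; clear GE.
pose F := mean_fun P f; pose q := composite phi F.
set r := Num.sqrt (4 * rho * G ^+ 2 * K%:R / Delta) in run.
have r0 : 0 <= r by exact: sqrtr_ge0.
have f_cont s : continuous (f s) by exact: locally_lipschitz_continuous.
have C_le' s y : C s <= f s y.
  by rewrite -lee_fin (le_trans (C_le s))//; apply: ereal_inf_lbound; exists y.
have phi_cvx := strongly_convex_on phi_proper lambda_ge0 phi_sconvex.
have rho0 : 0 < rho by rewrite rhoE; exact: mean_gt0.
have F_lip := objective_lipschitz f_cont f_int C_le' U_open U_convex rhos_gt0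
  f_wconvex Gs_meas Gs_int Gs_bound.
have F_wcvx : weakly_convex rho F by rewrite rhoE; exact: mean_fun_wconvex.
have [y0 Dy0] := phi_proper.2.
have psi_dom y : edom phi y -> psi y = (q y)%:E.
  by move=> Dy; rewrite psiE -(edom_fineK phi_proper Dy).
have [xs xs_min] := psi_min.
have Dxs : edom phi xs.
  rewrite /edom/= ltNge leye_eq; apply/negP => /eqP xsoo.
  have := xs_min y0; rewrite (psi_dom _ Dy0).
  by rewrite psiE xsoo addey// leye_eq.
have q_ge y : edom phi y -> q xs <= q y.
  by move=> Dy; rewrite -lee_fin -(psi_dom _ Dxs) -(psi_dom _ Dy).
have psi_inf : emin psi = (q xs)%:E.
  apply/eqP; rewrite eq_le; apply/andP; split.
    by apply: ge_ereal_inf; exists (psi xs); [exists xs|rewrite psi_dom].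
  by apply: le_ereal_inf_tmp => _ [y _ <-]; rewrite -(psi_dom _ Dxs); exact: xs_min.
have L0 : 0 <= mean P Gs by exact: mean_ge0.
have [prox proxP] := choice (fun y =>
  composite_prox phi_proper phi_closed rho0 L0 dom_U F_lip y q_ge).
have q_wcvx := composite_wconvex F_wcvx phi_cvx.
have envE y : env (1 / (2 * rho)) psi y = (menv q rho prox y)%:E.
  by rewrite psiE; exact: (env_composite phi_proper rho0 proxP).
pose V := gap P f phi rhos prox (q xs).
have VE y : V y = menv q rho prox y - q xs by rewrite /V /gap -rhoE.
have V_x0 : V x0 <= Delta by move: Delta_ge; rewrite envE psi_inf lee_fin VE.
rewrite rhoE in proxP.
have V_ge0 y : 0 <= V y by exact: gap_ge0.
(* The initial point lies in [U], the later ones in the domain of [phi]. *)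
have x_U k : (k <= K)%N -> forall w, U (x k w).
  case: k => [_ w|k kK w]; first by rewrite (sps_init run).
  apply: dom_U; exact: (model_argmin_dom phi_proper (sps_step run kK w) Dy0).
have x_meas k : (k <= K)%N -> measurable_rV (x k) by exact: (sps_x_meas run).
pose dist k := mean Pr (prox_dist prox \o x k).
pose B := rho + r / 2 + rho / 3.
pose err := rho * (G ^+ 2 / (r / 2 + rho / 12)).
have step k : (k < K)%N -> L1 Pr (V \o x k) ->
    L1 Pr (V \o x k.+1) /\
    2 * rho ^+ 2 / 3 * dist k <=
    B * (mean Pr (V \o x k) - mean Pr (V \o x k.+1)) + err.
  move=> kK iV; rewrite /B /err G2E rhoE.
  apply: (expected_decrease f_cont f_int C_le' phi_proper phi_cvx U_open U_convex
    dom_U rhos_gt0 f_wconvex rhos_int Gs_ge0 Gs_meas Gs_int Gs_bound proxP q_ge r0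
    _ (sps_S_meas run kK) (sps_law run kK) (sps_indep run kK) _
    (x_meas _ (ltnW kK)) (x_meas _ kK) (x_U _ (ltnW kK)) (sps_g run kK) _ iV).
  - apply: smallest_sub; first exact: sigma_algebra_measurable.
    move=> A [[i /= ik]|[i /= ik]].
      apply: rV_events_measurable; apply: x_meas.
      by rewrite -ltnS (leq_trans ik)// ltnS ltnW.
    have iK := ltn_trans ik kK.
    case=> [[Y mY <-]|]; first exact: (sps_S_meas run iK).
    by apply: rV_events_measurable; exact: (sps_g_meas run iK).
  - by move=> A xA; apply: sub_sigma_algebra; left; exists k => //=.
  - by move=> w; have := sps_step run kK w; rewrite rhoE.
have sum_step k : (k <= K)%N -> L1 Pr (V \o x k) /\
    2 * rho ^+ 2 / 3 * (\sum_(i < k) dist i) <=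
    B * (V x0 - mean Pr (V \o x k)) + k%:R * err.
  elim: k => [_|k IH kK].
    have -> : V \o x 0%N = fun=> V x0.
      by apply/funext => w; rewrite /= (sps_init run).
    split; first exact: L1_cst.
    by rewrite big_ord0 mean_cst subrr !mulr0 mul0r addr0.
  have [iV IHk] := IH (ltnW kK); have [iV1 stepk] := step k kK iV.
  by split => //; rewrite big_ord_recr/= -natr1; lra.
have [_ sumK] := sum_step K (leqnn K).
have B0 : 0 < B by rewrite /B; lra.
have total : 2 * rho ^+ 2 / 3 * (\sum_(i < K) dist i) <= B * Delta + K%:R * err.
  apply: (le_trans sumK); rewrite lerD2r ler_pM2l//.
  by have := mean_ge0 Pr (fun w => V_ge0 (x K w)); lra.
have iD k : (k < K)%N -> L1 Pr (prox_dist prox \o x k).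
  move=> kK; have iV := (sum_step k (ltnW kK)).1.
  exact: (prox_dist_int f_int phi_cvx rhos_gt0 f_wconvex rhos_int proxP q_ge
    (x_meas k (ltnW kK)) iV).
rewrite -rhoE in proxP.
have cD := continuous_prox_dist rho0 q_wcvx proxP.
have [iJ meanJ] := mean_uniform_index J_unif
  (fun k kK => x_meas k (ltnW kK)) cD (fun y => sqr_ge0 _) iD.
have grad w : enorm (gradient (fine \o env (1 / (2 * rho)) psi) (x (J w) w)) ^+ 2 =
    4 * rho ^+ 2 * prox_dist prox (x (J w) w).
  rewrite (_ : fine \o _ = menv q rho prox); last first.
    by apply/funext => y /=; rewrite envE.
  rewrite (gradient_menv rho0 q_wcvx proxP) enormZ exprMn /prox_dist.
  by rewrite real_normK ?num_real// exprMn; congr (_ * _ * _); ring.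
under [X in ('E_Pr[X])%E]eq_fun => w do rewrite grad.
rewrite mean_EFin ?lee_fin; last exact: L1Z.
rewrite meanZ// meanJ; apply: (@rate_bound _ _ _ _ _ r) => //.
by rewrite ltr0n.
Qed.
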